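(* Let $\rho$ be a density operator on $h$ with $\mathrm{tr}\,\rho>0$ that commutes with the fermionic parity $e^{i\pi\sum_ia_i^\dagger a_i}$, and let $\rho_0$ denote $\rho$ placed on slice $0$. Define, in $\mathcal K$, $$|\Phi^+\rangle:=\exp\Big(\sum_{t,j}a^\dagger_{tj}\tilde a^\dagger_{tj}\Big)|\Omega\rangle\!\rangle,\qquad |\Psi\rangle:=\rho_0e^{i\tilde{\mathcal S}/2}|\Phi^+\rangle,\qquad |\overline\Psi\rangle:=\big(Pe^{i\tilde{\mathcal S}/2}\big)^\dagger|\Phi^+\rangle,$$ and $$R:=\frac{|\Psi\rangle\langle\overline\Psi|}{\langle\overline\Psi|\Psi\rangle}.$$ Then $R$ is well defined, $R^2=R$, and $\mathrm{Tr}_{\mathcal K}R=1$. Moreover, for all operators $O^{(0)},\dots,O^{(N-1)}$ on $h$, with $O^{(t)}_t$ placed on slice $t$ (acting only on system modes), $$\frac{\mathrm{Tr}\big[P\rho_0e^{i\tilde{\mathcal S}}\prod_tO^{(t)}_t\big]}{\mathrm{Tr}\big[P\rho_0e^{i\tilde{\mathcal S}}\big]}=\mathrm{Tr}_{\mathcal K}\Big[R\prod_tO^{(t)}_t\Big].$$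
   Context: Fix integers $L\ge1$, $N\ge1$, a real $\epsilon>0$, and set $T=\epsilon N$. The space $h$. Let $h$ be the fermionic Fock space of $L$ modes, with vacuum $|0\rangle$, ladder operators $a_i$ satisfying $\{a_i,a_j^\dagger\}=\delta_{ij}$ and $\{a_i,a_j\}=\{a_i^\dagger,a_j^\dagger\}=0$, and trace $\mathrm{tr}$. The space $\mathcal H$. Let $\mathcal H$ be the Fock space generated from a vacuum $|\Omega\rangle$ by $a_{ti}$, $t=0,\dots,N-1$, $i=1,\dots,L$, with $\{a_{ti},a^\dagger_{t'j}\}=\delta_{tt'}\delta_{ij}$ and all other anticommutators zero. The symbol $\mathrm{Tr}$ denotes the trace on $\mathcal H$. Time translations and parity. Set $\omega_n=(2n+1)\pi/T$ and $\hat a_{ni}=N^{-1/2}\sum_te^{i\omega_n\epsilon t}a_{ti}$. Define $$\mathcal P=\sum_{n,j}\omega_n\hat a^\dagger_{nj}\hat a_{nj},\qquad P=\exp\Big(i\pi\sum_{t,i}a^\dagger_{ti}a_{ti}\Big).$$ Placing operators on a slice. For an operator $O$ on $h$, $O_t$ is its image under the unital $*$-homomorphism determined by $a_i\mapsto a_{ti}$. Quantum action. Let $H$ be a time-independent, hermitian, parity-preserving Hamiltonian on $h$ (an even polynomial in the ladder operators), and write $H_t$ for $H$ placed on slice $t$. Define $$e^{i\mathcal S}=e^{i\epsilon\mathcal P}\prod_te^{-i\epsilon H_t},\qquad \mathcal V=\prod_te^{i\epsilon tH_t},$$ $$e^{i\tilde{\mathcal S}}:=e^{iTH_0}e^{i\mathcal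 S}\ \big(=\mathcal V^\dagger e^{i\epsilon\mathcal P}\mathcal V\big),\qquad e^{i\tilde{\mathcal S}/2}:=\mathcal V^\dagger e^{i\epsilon\mathcal P/2}\mathcal V.$$ Environment. Enlarge the system by environment modes $\tilde a_{ti}$. Let $\mathcal K$ be the Fock space on the $2LN$ modes $a_{ti},\tilde a_{ti}$, all satisfying canonical anticommutation relations; modes with different labels anticommute (e.g. $\{a_{ti},\tilde a^\dagger_{t'j}\}=0$). Let $|\Omega\rangle\!\rangle$ be the global vacuum. All operators built from the $a_{ti}$ (including $P$, $\mathcal P$, $H_t$, $\rho_0$, $O_t$) are regarded also as operators on $\mathcal K$ acting trivially on environment modes. $\mathrm{Tr}_{\mathcal K}$ denotes the trace on $\mathcal K$. *)

(* Defs.v *)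
From HB Require Import structures.
From mathcomp Require Import all_boot all_order all_algebra.
From mathcomp Require Import all_classical all_reals all_analysis.
From mathcomp Require Import complex.
Import numFieldNormedType.Exports.
Import Order.TTheory GRing.Theory Num.Theory.

Set Implicit Arguments.
Unset Strict Implicit.
Unset Printing Implicit Defensive.

Local Open Scope ring_scope.
Local Open Scope complex_scope.

Section Fermions.
Variable R : realType.
Local Notation C := R[i].

Definition clim (u : nat -> C) : C :=
  Complex (limn (fun n => complex.Re (u n))) (limn (fun n => complex.Im (u n))).

Definition expm n (A : 'M[C]_n) : 'M[C]_n :=
  \matrix_(i, j) clim (fun m => (\sum_(k < m) (k`!%:R)^-1 *: A ^+ k) i j).

Definition expi (theta : R) : C := Complex (cos theta) (sin theta).

Definition adj m n (A : 'M[C]_(m, n)) : 'M[C]_(n, m) := (map_mx (@conjc R) A)^T.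

Definition density n (rho : 'M[C]_n) : Prop :=
  forall v : 'cV[C]_n, 0 <= (adj v *m rho *m v) 0 0.

(* basis vectors of C^(2^M) are labelled by s : 'I_(2^M); bit k of s is the
   occupation of mode k; index 0 is the vacuum. *)
Definition occ M (s : 'I_(2 ^ M)) (k : 'I_M) : bool := odd (s %/ 2 ^ k)%N.

Definition ann M (k : 'I_M) : 'M[C]_(2 ^ M) :=
  \matrix_(s, s')
    if occ s' k && (s == (s' - 2 ^ k)%N :> nat)
    then (-1) ^+ (\sum_(l < M | (l < k)%N) (occ s' l : nat)) else 0.

Definition vac M : 'cV[C]_(2 ^ M) := \col_(s < 2 ^ M) ((s == 0 :> nat)%:R).

Definition numop M : 'M[C]_(2 ^ M) := \sum_(k < M) adj (ann k) *m ann k.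
Definition parity M : 'M[C]_(2 ^ M) := expm (Complex 0 pi *: numop M).

(* The unital *-homomorphism determined by a_k |-> f k:
   it sends the matrix unit |s><s'| = cr(s) |0><0| cr(s')^dagger, where
   cr(s) = prod_{k in s, increasing} a_k^dagger and |0><0| = prod_k a_k a_k^dagger,
   to the same expression in the f k. *)
Definition embed M D (f : 'I_M -> 'M[C]_D) (A : 'M[C]_(2 ^ M)) : 'M[C]_D :=
  let cr (s : 'I_(2 ^ M)) := \prod_(k < M | occ s k) adj (f k) in
  let vp := \prod_(k < M) (f k *m adj (f k)) in
  \sum_(s < 2 ^ M) \sum_(s' < 2 ^ M) A s s' *: (cr s *m vp *m adj (cr s')).

Section Slices.
Variables (L N : nat) (eps : R).

Definition aH (t : 'I_N) (i : 'I_L) : 'M[C]_(2 ^ (N * L)) :=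
  ann (mxvec_index t i).

Definition slice (t : 'I_N) (O : 'M[C]_(2 ^ L)) : 'M[C]_(2 ^ (N * L)) :=
  embed (fun i => aH t i) O.

Definition PH : 'M[C]_(2 ^ (N * L)) := parity (N * L).

Definition Tt : R := eps * N%:R.
Definition omega (n : nat) : R := (2 * n + 1)%N%:R * pi / Tt.

Definition ahat (n : nat) (i : 'I_L) : 'M[C]_(2 ^ (N * L)) :=
  ((Num.sqrt (N%:R : R))^-1)%:C *:
    \sum_(t < N) expi (omega n * eps * t%:R) *: aH t i.

Definition Pcal : 'M[C]_(2 ^ (N * L)) :=
  \sum_(n < N) \sum_(j < L) (omega n)%:C *: (adj (ahat n j) *m ahat n j).

Variable H : 'M[C]_(2 ^ L).
Variable t0 : 'I_N. (* the slice 0 *)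

Definition Hs (t : 'I_N) := slice t H.

Definition eS : 'M[C]_(2 ^ (N * L)) :=
  expm (Complex 0 eps *: Pcal) *m \prod_(t < N) expm (Complex 0 (- eps) *: Hs t).

Definition Vop : 'M[C]_(2 ^ (N * L)) :=
  \prod_(t < N) expm (Complex 0 (eps * t%:R) *: Hs t).

Definition eSt : 'M[C]_(2 ^ (N * L)) := expm (Complex 0 Tt *: Hs t0) *m eS.

Definition eSt2 : 'M[C]_(2 ^ (N * L)) :=
  adj Vop *m expm (Complex 0 (eps / 2) *: Pcal) *m Vop.

Definition MK := (N * L + N * L)%N.
Definition sysK (t : 'I_N) (i : 'I_L) : 'M[C]_(2 ^ MK) :=
  ann (lshift (N * L) (mxvec_index t i)).
Definition envK (t : 'I_N) (i : 'I_L) : 'M[C]_(2 ^ MK) :=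
  ann (rshift (N * L) (mxvec_index t i)).

Definition liftHK (X : 'M[C]_(2 ^ (N * L))) : 'M[C]_(2 ^ MK) :=
  embed (fun k => ann (lshift (N * L) k)) X.

Definition PhiPlus : 'cV[C]_(2 ^ MK) :=
  expm (\sum_(t < N) \sum_(j < L) adj (sysK t j) *m adj (envK t j)) *m vac MK.

Variable rho : 'M[C]_(2 ^ L).
Definition rho0 := slice t0 rho.

Definition Psi : 'cV[C]_(2 ^ MK) := liftHK rho0 *m liftHK eSt2 *m PhiPlus.
Definition PsiBar : 'cV[C]_(2 ^ MK) := adj (liftHK PH *m liftHK eSt2) *m PhiPlus.

Definition overlap : C := (adj PsiBar *m Psi) 0 0.

Definition Rop : 'M[C]_(2 ^ MK) := overlap^-1 *: (Psi *m adj PsiBar).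

End Slices.
End Fermions.

(* Main.v *)
Require Import Defs.
From HB Require Import structures.
From mathcomp Require Import all_boot all_order all_algebra.
From mathcomp Require Import all_classical all_reals all_analysis.
From mathcomp Require Import complex ring lra.
Import Order.TTheory GRing.Theory Num.Theory.
Local Open Scope ring_scope.
Import numFieldNormedType.Exports.

(** Both expectation values are traces over the system Fock space. The vector [Phi+] satisfies
    [a Phi+ = a~^* Phi+] and [a~ Phi+ = - a^* Phi+], hence [Y |-> <Phi+|Y|Phi+>] is cyclic on system
    operators; it takes the value 1 on the vacuum projector, so it is the trace. With
    [U2 = e^{iS~/2}] this gives [<Psibar|O|Psi> = Tr (P U2 O rho_0 U2) = Tr (P rho_0 e^{iS~} O)], because
    [U2] is even and [U2^2 = V^* U V = e^{iS~}] for [U = e^{i eps Pcal}]; the last equality follows from the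
    antiperiodic translation [U a_t = a_{t+1} U], [U a_{N-1} = - a_0 U].

    For the denominator, [V] commutes with [rho_0], so [Tr (P rho_0 e^{iS~}) = Tr (P U rho_0)].
    Carrying an operator of slice 0 once around the time circle shows that [Tr (P U .)] is cyclic on that
    slice; it is 1 on the vacuum projector of slice 0, which the same argument enlarges to the global
    vacuum projector. So the denominator is [tr rho], which is positive. *)

(** The $O^{(t)}$ and the ladder operators need not be even, so neither functional is shown to be
    cyclic on a whole algebra. A single ladder operator is moved only against operators [Y] that the
    carriers (ladder operators of other slices, or of the environment) cross up to conjugation by
    the parity $P$. This class is closed under products and contains the ladder operators of the
    family concerned. That suffices, because embedded operators are combinations of words in these
    ladder operators. On the time circle two signs meet: one from antiperiodicity at the last slice,
    one from carrying a ladder operator past $P$. They cancel, which is why inserting $P$ yields an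
    ordinary trace on the slice. The exponential is an entrywise limit of partial sums. Facts about
    it come from three sources: an intertwining relation $XA=BX$ passed to the limit,
    diagonalisation for hermitian generators, and, for $|\Phi^+\rangle$, a commutator computed on
    partial sums. *)

Set Implicit Arguments.
Unset Strict Implicit.

(** * Entrywise complex limits and convergence of the matrix exponential *)

Section MatrixExponential.
Variable R : realType.
Local Notation C := R[i].
Local Notation cRe := (@complex.Re R).
Local Notation cIm := (@complex.Im R).
Implicit Types (u v : nat -> C) (a b l : C).

Lemma cReD a b : cRe (a + b) = cRe a + cRe b.
Proof. by case: a b => [? ?] [? ?]. Qed.

Lemma cImD a b : cIm (a + b) = cIm a + cIm b.
Proof. by case: a b => [? ?] [? ?]. Qed.

Lemma cReM a b : cRe (a * b) = cRe a * cRe b - cIm a * cIm b.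
Proof. by case: a b => [? ?] [? ?]. Qed.

Lemma cImM a b : cIm (a * b) = cRe a * cIm b + cIm a * cRe b.
Proof. by case: a b => [? ?] [? ?]. Qed.

Lemma complex_eq a b : cRe a = cRe b -> cIm a = cIm b -> a = b.
Proof. by case: a b => [? ?] [? ?] /= -> ->. Qed.

Definition ccvg u l : Prop :=
  ((fun n => cRe (u n)) @ \oo --> cRe l)%classic /\
  ((fun n => cIm (u n)) @ \oo --> cIm l)%classic.

Lemma ccvg_clim u l : ccvg u l -> clim u = l.
Proof.
by move=> [h1 h2]; apply: complex_eq; rewrite /clim /=; apply/cvg_lim.
Qed.

Lemma ccvg_unique u l l' : ccvg u l -> ccvg u l' -> l = l'.
Proof. by move=> /ccvg_clim <- /ccvg_clim <-. Qed.

Lemma ccvg_cst l : ccvg (fun=> l) l.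
Proof. by split; apply: cvg_cst. Qed.

Lemma ccvgD u v l l' : ccvg u l -> ccvg v l' -> ccvg (fun n => u n + v n) (l + l').
Proof.
move=> [h1 h2] [h3 h4]; split.
  by rewrite cReD; under eq_fun do rewrite cReD; apply: cvgD.
by rewrite cImD; under eq_fun do rewrite cImD; apply: cvgD.
Qed.

Lemma ccvgZ a u l : ccvg u l -> ccvg (fun n => a * u n) (a * l).
Proof.
move=> [h1 h2]; split.
  rewrite cReM; under eq_fun do rewrite cReM.
  by apply: cvgB; apply: cvgMr.
rewrite cImM; under eq_fun do rewrite cImM.
by apply: cvgD; apply: cvgMr.
Qed.

Lemma ccvg_sum (I : Type) (r : seq I) (P : pred I) (u : I -> nat -> C) (l : I -> C) :
  (forall i, P i -> ccvg (u i) (l i)) ->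
  ccvg (fun n => \sum_(i <- r | P i) u i n) (\sum_(i <- r | P i) l i).
Proof.
move=> h; elim: r => [|i r IH].
  by under [X in ccvg X _]eq_fun do rewrite big_nil; rewrite big_nil; apply: ccvg_cst.
under [X in ccvg X _]eq_fun do rewrite big_cons; rewrite big_cons.
by case: ifP => // Pi; apply: ccvgD => //; apply: h.
Qed.

Lemma ccvg_shiftE u l : ccvg (fun n => u n.+1) l = ccvg u l.
Proof.
by rewrite /ccvg (cvg_shiftS (fun n => cRe (u n))) (cvg_shiftS (fun n => cIm (u n))).
Qed.

Definition mcvg m n (S : nat -> 'M[C]_(m, n)) (B : 'M[C]_(m, n)) : Prop :=
  forall i j, ccvg (fun k => S k i j) (B i j).

Lemma mcvg_unique m n (S : nat -> 'M[C]_(m, n)) A B : mcvg S A -> mcvg S B -> A = B.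
Proof. by move=> hA hB; apply/matrixP => i j; apply: ccvg_unique (hA i j) (hB i j). Qed.

Lemma mcvg_mull p m n (X : 'M[C]_(p, m)) (S : nat -> 'M[C]_(m, n)) B :
  mcvg S B -> mcvg (fun k => X *m S k) (X *m B).
Proof.
move=> h i j; under [X in ccvg X _]eq_fun do rewrite mxE; rewrite mxE.
by apply: ccvg_sum => l _; apply: ccvgZ.
Qed.

Lemma mcvg_mulr m n p (X : 'M[C]_(n, p)) (S : nat -> 'M[C]_(m, n)) B :
  mcvg S B -> mcvg (fun k => S k *m X) (B *m X).
Proof.
move=> h i j; under [X in ccvg X _]eq_fun do rewrite mxE; rewrite mxE.
apply: ccvg_sum => l _; rewrite mulrC.
by under [X in ccvg X _]eq_fun do rewrite mulrC; apply: ccvgZ.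
Qed.

Lemma mcvg_shift m n (S : nat -> 'M[C]_(m, n)) B :
  mcvg S B -> mcvg (fun k => S k.+1) B.
Proof. by move=> h i j; rewrite (ccvg_shiftE (fun k => S k i j)). Qed.

Definition expm_psum n (A : 'M[C]_n) (m : nat) : 'M[C]_n :=
  \sum_(k < m) (k`!%:R)^-1 *: A ^+ k.

Lemma cReZ (x : R) a : cRe (x%:C%C * a) = x * cRe a.
Proof. by rewrite cReM /= mul0r subr0. Qed.

Lemma cImZ (x : R) a : cIm (x%:C%C * a) = x * cIm a.
Proof. by rewrite cImM /= mul0r addr0. Qed.

Lemma ge_norm_cRe a (x : R) : `|a| <= x%:C%C -> `|cRe a| <= x.
Proof.
by move=> h; rewrite -lecR; apply: le_trans h; apply: normc_ge_Re.
Qed.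

Lemma ge_norm_cIm a (x : R) : `|a| <= x%:C%C -> `|cIm a| <= x.
Proof.
have -> : cIm a = - cRe (a * 'i%C) by rewrite ReiNIm opprK.
move=> h; rewrite normrN; apply: ge_norm_cRe; rewrite normrM.
by rewrite (_ : `|'i%C| = 1) ?mulr1// normc_def /= expr0n expr1n add0r sqrtr1.
Qed.

Lemma norm_expmx_le n (A : 'M[C]_n) :
  exists c : R, 0 <= c /\ forall k i j, `|(A ^+ k) i j| <= (c ^+ k)%:C%C.
Proof.
(* The sum of the moduli of all entries dominates every row sum, so each further factor [A] costs at
   most one factor [s]. *)
pose s : C := \sum_i \sum_j `|A i j|.
have sge0 : 0 <= s by apply: sumr_ge0 => i _; apply: sumr_ge0.
have sE : s = (cRe s)%:C%C by rewrite RRe_real// ger0_real.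
exists (cRe s); split; first by rewrite -ler0c -sE.
elim=> [|k IH] i j.
  by rewrite expr0 mxE; case: (_ == _); rewrite ?normr0 ?normr1 ?expr0 ?ler01.
rewrite !exprS mxE rmorphM /= -sE; apply: le_trans (ler_norm_sum _ _ _) _.
apply: (@le_trans _ _ (\sum_l `|A i l| * (cRe s ^+ k)%:C%C)).
  by apply: ler_sum => l _; rewrite normrM ler_wpM2l.
rewrite -mulr_suml ler_wpM2r//; first exact: le_trans (IH i j).
rewrite /s [leRHS](bigD1 i)//= lerDl; apply: sumr_ge0 => i' _; exact: sumr_ge0.
Qed.

Lemma dominated_exp_cvg (f : nat -> R) (c : R) : 0 <= c ->
  (forall k, `|f k| <= c ^+ k) ->
  cvgn (fun m => \sum_(k < m) (k`!%:R)^-1 * f k).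
Proof.
move=> c0 hf.
have -> : (fun m => \sum_(k < m) (k`!%:R)^-1 * f k)
          = series (fun k => (k`!%:R)^-1 * f k).
  by apply/funext => m; rewrite /series /= big_mkord.
apply: normed_cvg; apply: series_le_cvg (is_cvg_series_exp_coeff c) => k.
- exact: normr_ge0.
- exact: exp_coeff_ge0.
- by rewrite /exp_coeff /= normrM mulrC [`|_^-1|]ger0_norm ?invr_ge0// ler_wpM2r// invr_ge0.
Qed.

(** Entries of powers grow at most geometrically, so the real and imaginary series are dominated by
    a real exponential series. Hence the limits inside [clim] are genuine and not default values. *)
Lemma expm_psum_cvg n (A : 'M[C]_n) : mcvg (expm_psum A) (expm A).
Proof.
have [c [c0 hc]] := norm_expmx_le A.
move=> i j; rewrite /expm mxE /clim.
have natC k : ((k`!%:R)^-1 : C) = ((k`!%:R)^-1)%:C%C.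
  by rewrite -[in LHS](rmorph_nat (real_complex R)) fmorphV.
have ReE m : cRe (expm_psum A m i j) = \sum_(k < m) (k`!%:R)^-1 * cRe ((A ^+ k) i j).
  rewrite summxE (big_morph cRe cReD (erefl : cRe 0 = 0)).
  by apply: eq_bigr => k _; rewrite mxE natC cReZ.
have ImE m : cIm (expm_psum A m i j) = \sum_(k < m) (k`!%:R)^-1 * cIm ((A ^+ k) i j).
  rewrite summxE (big_morph cIm cImD (erefl : cIm 0 = 0)).
  by apply: eq_bigr => k _; rewrite mxE natC cImZ.
have cvRe : cvgn (fun m => cRe (expm_psum A m i j)).
  by under eq_fun do rewrite ReE; apply: (dominated_exp_cvg (f:=fun k => cRe ((A ^+ k) i j)) c0) => k;
    apply: ge_norm_cRe.
have cvIm : cvgn (fun m => cIm (expm_psum A m i j)).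
  by under eq_fun do rewrite ImE; apply: (dominated_exp_cvg (f:=fun k => cIm ((A ^+ k) i j)) c0) => k;
    apply: ge_norm_cIm.
by split; [exact: cvRe | exact: cvIm].
Qed.

Lemma expm_unique n (A B : 'M[C]_n) : mcvg (expm_psum A) B -> expm A = B.
Proof. exact/mcvg_unique/expm_psum_cvg. Qed.

(** The relation holds for all powers and survives the limit. [X] may be rectangular, so that a
    vector can play its role, with a 1 by 1 matrix [A]. *)
Lemma expm_intertwine m n (X : 'M[C]_(m, n)) (A : 'M[C]_n) (B : 'M[C]_m) :
  X *m A = B *m X -> X *m expm A = expm B *m X.
Proof.
move=> h; apply: (@mcvg_unique _ _ (fun k => X *m expm_psum A k)).
  exact/mcvg_mull/expm_psum_cvg.
have -> : (fun k => X *m expm_psum A k) = (fun k => expm_psum B k *m X).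
  apply/funext => k; rewrite mulmx_suml mulmx_sumr; apply: eq_bigr => i _.
  rewrite -scalemxAl -scalemxAr; congr (_ *: _).
  elim: (i : nat) => [|l IH]; first by rewrite !expr0 mulmx1 mul1mx.
  by rewrite exprSr [B ^+ _]exprSr mulmxA IH -!mulmxA h.
exact/mcvg_mulr/expm_psum_cvg.
Qed.

Lemma expm0 n : expm (0 : 'M[C]_n) = 1%:M.
Proof.
apply: expm_unique => i j.
(* The empty partial sum is 0; only from index 1 on is the sequence constantly the identity. *)
have h : ccvg (fun k => expm_psum 0 k.+1 i j) ((1%:M : 'M[C]_n) i j).
  rewrite (_ : (fun _ => _) = fun=> (1%:M : 'M[C]_n) i j); first exact: ccvg_cst.
  apply/funext => k; rewrite /expm_psum big_ord_recl expr0 fact0 invr1 scale1r.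
  by rewrite big1 ?addr0// => l _; rewrite exprS mul0r scaler0.
by rewrite -(ccvg_shiftE (fun k => expm_psum 0 k i j)).
Qed.

End MatrixExponential.

(** * Unitary one-parameter groups generated by hermitian matrices *)

Section HermitianExponential.
Variable R : realType.
Local Notation C := R[i].

Lemma complex0Z (x : R) : Complex 0 x = Complex 0 1 * x%:C%C.
Proof. by apply: complex_eq; rewrite ?cReM ?cImM /=; rewrite ?mul0r ?mul1r ?mulr0 ?subr0 ?addr0 ?add0r. Qed.

Lemma expi0 : expi 0 = 1 :> C.
Proof. by rewrite /expi sin0 cos0. Qed.

Lemma expiD (x y : R) : expi (x + y) = expi x * expi y.
Proof. by apply: complex_eq; rewrite ?cReM ?cImM /= ?cosD ?sinD// [RHS]addrC. Qed.

Lemma conj_expi (x : R) : ((expi x)^*)%C = expi (- x).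
Proof. by rewrite /expi /= cosN sinN. Qed.

Lemma expi_pi : expi pi = -1 :> C.
Proof. by apply: complex_eq; rewrite /= ?cospi ?sinpi ?oppr0. Qed.

Lemma expiMn (x : R) n : expi (x * n%:R) = expi x ^+ n.
Proof.
by elim: n => [|n IH]; rewrite ?mulr0 ?expi0 ?expr0// -addn1 natrD mulrDr mulr1 expiD IH exprD.
Qed.

(** The closed form copies [cos_coeff] and [sin_coeff], including the exponent [k.-1./2]; at [k = 0]
    the factor [(odd k)%:R] removes that term. *)
Lemma iexpr (x : R) k : (Complex 0 x) ^+ k =
  Complex ((~~ odd k)%:R * (-1) ^+ k./2 * x ^+ k) ((odd k)%:R * (-1) ^+ k.-1./2 * x ^+ k).
Proof.
elim: k => [|k IH].
  by apply: complex_eq; rewrite /= ?expr0 ?mulr1 ?mul0r.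
rewrite exprS IH; apply: complex_eq; rewrite ?cReM ?cImM /= !mul0r ?sub0r ?add0r.
  rewrite uphalf_half; case: k {IH} => [|k]; first by rewrite /= !mul0r mulr0 oppr0.
  rewrite /= uphalf_half !negbK; case: (odd k); rewrite /= ?mul0r ?mulr0 ?oppr0//.
  by rewrite add0n !mul1r exprD expr1 mulN1r !mulNr mulrCA -exprS.
by rewrite mulrCA -exprS.
Qed.

Lemma expi_series_cvg (x : R) :
  ccvg (fun m => \sum_(k < m) (k`!%:R)^-1 * (Complex 0 x) ^+ k) (expi x).
Proof.
have natC k : ((k`!%:R)^-1 : C) = ((k`!%:R)^-1)%:C%C.
  by rewrite -[in LHS](rmorph_nat (real_complex R)) fmorphV.
split.
  have -> : (fun m => complex.Re (\sum_(k < m) (k`!%:R)^-1 * (Complex 0 x) ^+ k))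
           = series (cos_coeff x).
    apply/funext => m; rewrite (big_morph _ (@cReD R) (erefl : complex.Re 0 = 0)).
    rewrite /series /= big_mkord; apply: eq_bigr => k _.
    by rewrite natC cReZ iexpr /= mulrC.
  by rewrite /= unlock; apply: is_cvg_series_cos_coeff.
have -> : (fun m => complex.Im (\sum_(k < m) (k`!%:R)^-1 * (Complex 0 x) ^+ k))
         = series (sin_coeff x).
  apply/funext => m; rewrite (big_morph _ (@cImD R) (erefl : complex.Im 0 = 0)).
  rewrite /series /= big_mkord; apply: eq_bigr => k _.
  by rewrite natC cImZ iexpr /= mulrC.
by rewrite /= unlock; apply: is_cvg_series_sin_coeff.
Qed.

Lemma diag_mxX n (d : 'rV[C]_n) k : diag_mx d ^+ k = diag_mx (\row_j d 0 j ^+ k).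
Proof.
elim: k => [|k IH].
  by apply/matrixP => i j; rewrite !mxE expr0.
by rewrite exprS IH; apply/matrixP => i j; rewrite -[_ * _]/(_ *m _) mul_diag_mx !mxE exprS mulrnAr.
Qed.

Lemma expm_diag n (d : 'I_n -> R) :
  expm (diag_mx (\row_j Complex 0 (d j))) = diag_mx (\row_j expi (d j)).
Proof.
apply: expm_unique => i j.
have -> : (fun k => expm_psum (diag_mx (\row_j0 Complex 0 (d j0))) k i j) =
   (fun m => (i == j)%:R * \sum_(k < m) (k`!%:R)^-1 * (Complex 0 (d j)) ^+ k).
  apply/funext => m; rewrite summxE mulr_sumr; apply: eq_bigr => k _.
  rewrite diag_mxX !mxE; case: eqP => [->|_]; rewrite ?mulr0n ?mul0r ?mulr0//.
  by rewrite mul1r mulr1n.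
have -> : diag_mx (\row_j0 expi (d j0)) i j = (i == j)%:R * expi (d j).
  by rewrite !mxE mulr_natl; case: eqP => [->|].
exact/ccvgZ/expi_series_cvg.
Qed.

Lemma adjK m n (A : 'M[C]_(m, n)) : adj (adj A) = A.
Proof. by apply/matrixP => i j; rewrite !mxE conjcK. Qed.

Lemma adjM m n p (A : 'M[C]_(m, n)) (B : 'M[C]_(n, p)) :
  adj (A *m B) = adj B *m adj A.
Proof. by rewrite /adj map_mxM trmx_mul. Qed.

Lemma adjD m n (A B : 'M[C]_(m, n)) : adj (A + B) = adj A + adj B.
Proof. by rewrite /adj map_mxD linearD. Qed.

Lemma adjN m n (A : 'M[C]_(m, n)) : adj (- A) = - adj A.
Proof. by rewrite /adj map_mxN linearN. Qed.

Lemma adj0 m n : adj (0 : 'M[C]_(m, n)) = 0.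
Proof. by rewrite /adj map_mx0 trmx0. Qed.

Lemma adj1 n : adj (1%:M : 'M[C]_n) = 1%:M.
Proof. by rewrite /adj map_mx1 trmx1. Qed.

Lemma adjZ m n a (A : 'M[C]_(m, n)) : adj (a *: A) = (a^*)%C *: adj A.
Proof. by rewrite /adj map_mxZ linearZ. Qed.

Lemma adj_sum m n (I : Type) (r : seq I) (P : pred I) (F : I -> 'M[C]_(m, n)) :
  adj (\sum_(i <- r | P i) F i) = \sum_(i <- r | P i) adj (F i).
Proof. exact: (big_morph _ (@adjD m n) (@adj0 m n)). Qed.

Lemma hermitian_diag n (A : 'M[C]_n) : adj A = A ->
  exists (P : 'M[C]_n) (d : 'I_n -> R),
    P *m adj P = 1%:M /\ A = adj P *m diag_mx (\row_j (d j)%:C%C) *m P.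
Proof.
move=> hA.
have conjE m p (B : 'M[C]_(m, p)) : (map_mx Num.conj B)^T = adj B.
  by [].
have hH : A \is hermsymmx.
  by apply/is_hermitianmxP; rewrite expr0 scale1r -map_trmx conjE hA.
have hN := hermitian_normalmx hH.
exists (spectralmx A), (fun j => complex.Re (spectral_diag A 0 j)).
have hU := spectral_unitarymx A.
split; first by apply/eqP; move: hU; rewrite qualifE/= -map_trmx conjE.
move: (orthomx_spectralP hN); rewrite invmx_unitary// -map_trmx conjE => {1}->.
congr (_ *m diag_mx _ *m _); apply/rowP => j; rewrite mxE RRe_real//.
by have /mxOverP := hermitian_spectral_diag_real hH; apply.
Qed.

Lemma expm_diagonalized n (P : 'M[C]_n) (d : 'I_n -> R) : P *m adj P = 1%:M ->
  expm (adj P *m diag_mx (\row_j Complex 0 (d j)) *m P)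
  = adj P *m diag_mx (\row_j expi (d j)) *m P.
Proof.
move=> hP; rewrite -expm_diag.
set A := _ *m _ *m _.
have h : adj P *m expm (diag_mx (\row_j Complex 0 (d j))) = expm A *m adj P.
  by apply: expm_intertwine; rewrite /A -!mulmxA hP mulmx1.
by rewrite h -mulmxA (mulmx1C hP) mulmx1.
Qed.

Section OneParameterGroup.
Variables (n : nat) (A : 'M[C]_n).
Hypothesis hA : adj A = A.
Local Notation E th := (expm (Complex 0 th *: A)).

(** One diagonalisation serves all times [th] and all shifts [c], so the group law and the effect of
    subtracting a scalar become identities between diagonal matrices. *)
Lemma expm_hermitian : exists (P : 'M[C]_n) (d : 'I_n -> R),
  [/\ P *m adj P = 1%:M,
     A = adj P *m diag_mx (\row_j (d j)%:C%C) *m P &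
     forall (th c : R), expm (Complex 0 th *: (A - c%:C%C%:M))
       = adj P *m diag_mx (\row_j expi (th * (d j - c))) *m P].
Proof.
have [P [d [hP hd]]] := hermitian_diag hA; exists P, d; split=> // th c.
rewrite -(expm_diagonalized _ hP); congr expm.
have -> : A - c%:C%C%:M = adj P *m diag_mx (\row_j (d j - c)%:C%C) *m P.
  rewrite {1}hd (_ : diag_mx (\row_j (d j - c)%:C%C)
                    = diag_mx (\row_j (d j)%:C%C) - c%:C%C%:M).
    by rewrite mulmxBr mulmxBl mul_mx_scalar -scalemxAl (mulmx1C hP) scalemx1.
  by apply/matrixP => i j; rewrite !mxE rmorphB mulrnBl.
rewrite scalemxAl scalemxAr; congr (_ *m _ *m _).
apply/matrixP => i j; rewrite !mxE; case: eqP => [->|_]; last by rewrite mulr0n mulr0.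
by rewrite !mulr1n [RHS]complex0Z [X in X * _]complex0Z rmorphM mulrA.
Qed.

Lemma expm_iE : exists (P : 'M[C]_n) (d : 'I_n -> R),
  P *m adj P = 1%:M /\
  forall th : R, E th = adj P *m diag_mx (\row_j expi (th * d j)) *m P.
Proof.
have [P [d [hP _ h]]] := expm_hermitian; exists P, d; split=> // th.
move: (h th 0); rewrite (_ : 0%:C%C%:M = 0) ?subr0; last by rewrite raddf0.
by move=> ->; congr (_ *m diag_mx _ *m _); apply/rowP => j; rewrite !mxE subr0.
Qed.

Lemma expm_iD (a b : R) : E (a + b) = E a *m E b.
Proof.
have [P [d [hP h]]] := expm_iE; rewrite !h !mulmxA; congr (_ *m _).
rewrite -2!mulmxA (mulmxA P) hP mul1mx -mulmxA; congr (_ *m _).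
by rewrite mulmx_diag; congr diag_mx; apply/rowP => j; rewrite !mxE mulrDl expiD.
Qed.

Lemma expm_i0 : E 0 = 1%:M.
Proof. by rewrite scale0r expm0. Qed.

Lemma adj_expm_i (a : R) : adj (E a) = E (- a).
Proof.
have [P [d [hP h]]] := expm_iE; rewrite !h !adjM adjK mulmxA; congr (_ *m _ *m _).
apply/matrixP => i j; rewrite !mxE eq_sym; case: eqP => [->|_].
  by rewrite !mulr1n conj_expi mulNr.
by rewrite !mulr0n conjc0.
Qed.

Lemma expm_iVl (a : R) : E (- a) *m E a = 1%:M.
Proof. by rewrite -expm_iD addNr expm_i0. Qed.

Lemma expm_iVr (a : R) : E a *m E (- a) = 1%:M.
Proof. by rewrite -expm_iD addrN expm_i0. Qed.

Lemma expm_i_subscalar (th c : R) :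
  expm (Complex 0 th *: (A - c%:C%C%:M)) = expi (- (th * c)) *: E th.
Proof.
have [P [d [hP _ h]]] := expm_hermitian; rewrite h.
move: (h th 0); rewrite (_ : 0%:C%C%:M = 0) ?subr0; last by rewrite raddf0.
move=> ->; rewrite scalemxAl scalemxAr; congr (_ *m _ *m _).
apply/matrixP => i j; rewrite !mxE subr0 mulrnAr; congr (_ *+ _).
by rewrite mulrBr expiD mulrC.
Qed.

End OneParameterGroup.
End HermitianExponential.

(** * Binary labels, anticommuting families and the operators embedded along them *)

Lemma odd_divn_inj M (a b : nat) : (a < 2 ^ M)%N -> (b < 2 ^ M)%N ->
  (forall k, (k < M)%N -> odd (a %/ 2 ^ k) = odd (b %/ 2 ^ k)) -> a = b.
Proof.
elim: M a b => [|M IH] a b; first by rewrite expn0 !ltnS !leqn0 => /eqP -> /eqP ->.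
move=> ha hb h; rewrite -(odd_double_half a) -(odd_double_half b).
have := h 0%N isT; rewrite expn0 !divn1 => ->; congr (_ + _.*2)%N.
apply: IH => [||k kM]; rewrite -!divn2 ?ltn_divLR// -?expnSr//.
by rewrite -!divnMA -!expnS; apply: h.
Qed.

Lemma occ_inj M (s s' : 'I_(2 ^ M)) : occ s =1 occ s' -> s = s'.
Proof.
move=> h; apply: val_inj; apply: (@odd_divn_inj M); rewrite ?ltn_ord// => k kM.
exact: (h (Ordinal kM)).
Qed.

Section CanonicalAnticommutation.
Variable R : realType.
Local Notation C := R[i].

(** The relation between two creation operators is the adjoint of the first clause. *)
Definition car M D (f : 'I_M -> 'M[C]_D) : Prop :=
  (forall i j, f i * f j = - (f j * f i)) /\
  (forall i j, f i * adj (f j) = (i == j)%:R - adj (f j) * f i).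

Definition occ_parity M (s : 'I_(2 ^ M)) : bool := odd (\sum_(k < M) occ s k).

(** Evenness is stated on matrix entries because [embed] is a sum over entries; commutation with the
    parity operator implies it ([even_op_parity]). *)
Definition even_op M (X : 'M[C]_(2 ^ M)) : Prop :=
  forall s s', occ_parity s != occ_parity s' -> X s s' = 0.

Lemma adjMr n (A B : 'M[C]_n) : adj (A * B) = adj B * adj A.
Proof. exact: adjM. Qed.

Lemma prod_intertwine D (b : 'M[C]_D) (I : Type) (r : seq I) (P : pred I)
    (F G : I -> 'M[C]_D) :
  (forall i, P i -> b * F i = G i * b) ->
  b * \prod_(i <- r | P i) F i = \prod_(i <- r | P i) G i * b.
Proof.
move=> h; elim: r => [|i r IH]; first by rewrite !big_nil mulr1 mul1r.
by rewrite !big_cons; case: ifP => // /h hi; rewrite mulrA hi -!mulrA IH.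
Qed.

Lemma adj_prod_intertwine D (b : 'M[C]_D) (I : Type) (r : seq I) (P : pred I)
    (F G : I -> 'M[C]_D) :
  (forall i, P i -> b * adj (F i) = adj (G i) * b) ->
  b * adj (\prod_(i <- r | P i) F i) = adj (\prod_(i <- r | P i) G i) * b.
Proof.
move=> h; elim: r => [|i r IH]; first by rewrite !big_nil adj1 mulr1 mul1r.
by rewrite !big_cons; case: ifP => // /h hi; rewrite !adjMr mulrA IH -!mulrA hi.
Qed.

(** An embedded operator is a sum of words in the family and its adjoints, so [b] can be pushed
    through letter by letter. With [g] another slice this transports operators in time; with [g] the
    negated family it handles anticommutation. *)
Lemma embed_intertwine M D (b : 'M[C]_D) (f g : 'I_M -> 'M[C]_D) X :
  (forall k, b * f k = g k * b) -> (forall k, b * adj (f k) = adj (g k) * b) ->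
  b * embed f X = embed g X * b.
Proof.
move=> h1 h2; rewrite /embed mulr_sumr mulr_suml; apply: eq_bigr => s _.
rewrite mulr_sumr mulr_suml; apply: eq_bigr => s' _.
rewrite -[_ * _]/(_ *m _) -[RHS]/(_ *m _) -scalemxAr -scalemxAl; congr (_ *: _).
rewrite -[LHS]/(b * (_ * _ * _)) -[RHS]/(_ * _ * _ * b).
have e1 : b * \prod_(k < M | occ s k) adj (f k) = \prod_(k < M | occ s k) adj (g k) * b.
  by apply: prod_intertwine => k _; apply: h2.
have e2 : b * \prod_(k < M) (f k *m adj (f k)) = \prod_(k < M) (g k *m adj (g k)) * b.
  apply: prod_intertwine => k _.
  by rewrite -[f k *m _]/(_ * _) -[g k *m _]/(_ * _) mulrA h1 -!mulrA h2.
have e3 : b * adj (\prod_(k < M | occ s' k) adj (f k))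
        = adj (\prod_(k < M | occ s' k) adj (g k)) * b.
  by apply: adj_prod_intertwine => k _; rewrite !adjK.
by rewrite !mulrA e1 -[_ * b * _]mulrA e2 !mulrA -[_ * b * _]mulrA e3 mulrA.
Qed.

Lemma prodN D (I : Type) (r : seq I) (P : pred I) (F : I -> 'M[C]_D) :
  \prod_(i <- r | P i) (- F i) = (-1) ^+ (\sum_(i <- r | P i) 1) *: \prod_(i <- r | P i) F i.
Proof.
elim: r => [|i r IH]; first by rewrite !big_nil expr0 scale1r.
rewrite !big_cons; case: ifP => // _.
by rewrite IH add1n exprS mulN1r scaleNr mulNr -[F i * (_ *: _)]/(_ *m _) -scalemxAr.
Qed.

Lemma sum_occ M (s : 'I_(2 ^ M)) : (\sum_(k < M | occ s k) 1)%N = (\sum_(k < M) occ s k)%N.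
Proof. by rewrite [LHS]big_mkcond; apply: eq_bigr => k _; case: occ. Qed.

(** The unit labelled by [s], [s'] acquires one sign per occupied mode of either label; these cancel
    when the two parities agree. Thus an operator that anticommutes with every letter commutes with
    an even [X]. *)
Lemma embed_opp M D (f : 'I_M -> 'M[C]_D) X : even_op X ->
  embed (fun k => - f k) X = embed f X.
Proof.
move=> hX; apply: eq_bigr => s _; apply: eq_bigr => s' _.
have [e|/hX ->] := eqVneq (occ_parity s) (occ_parity s'); last by rewrite !scale0r.
congr (_ *: _).
have crN (t : 'I_(2 ^ M)) : \prod_(k < M | occ t k) adj (- f k)
    = (-1) ^+ (occ_parity t) *: \prod_(k < M | occ t k) adj (f k).
  under eq_bigr => k _ do rewrite adjN.
  by rewrite prodN sum_occ -signr_odd.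
rewrite !crN adjZ -e -scalemxAr -!scalemxAl scalerA.
rewrite (_ : (((-1) ^+ _)^*)%C = (-1) ^+ occ_parity s); last first.
  by case: occ_parity; rewrite ?expr0 ?expr1 ?rmorphN ?rmorph1.
rewrite -signr_addb addbb scale1r; congr (_ *m _ *m _).
by apply: eq_bigr => k _; rewrite adjN mulmxN mulNmx opprK.
Qed.

Section Family.
Variables (M D : nat) (f : 'I_M -> 'M[C]_D).
Hypothesis hf : car f.
Local Notation cr s := (\prod_(k < M | occ s k) adj (f k)).
Local Notation vp := (\prod_(k < M) (f k *m adj (f k))).

Lemma car_sqr k : f k * f k = 0.
Proof.
have /eqP := hf.1 k k; rewrite -addr_eq0 -mulr2n -scaler_nat scaler_eq0.
by rewrite pnatr_eq0 => /eqP.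
Qed.

Lemma car_comm_number k l : l != k ->
  f l * (f k *m adj (f k)) = f k *m adj (f k) * f l.
Proof.
move=> lk; rewrite -!/(f k * adj (f k)) mulrA hf.1 mulNr -[X in - X]mulrA (hf.2 l k).
by rewrite (negPf lk) sub0r mulrN opprK mulrA.
Qed.

(** [f k] commutes with the factors of the other modes until it reaches its own, where its square
    vanishes. *)
Lemma car_vac k : f k * vp = 0.
Proof.
have : k \in index_enum 'I_M by rewrite mem_index_enum.
elim: (index_enum _) => // l r IH; rewrite in_cons big_cons.
have [<- _|kl /= /IH h] := eqVneq k l.
  by rewrite mulrA -[_ *m _]/(_ * _) mulrA car_sqr !mul0r.
by rewrite mulrA car_comm_number// -mulrA h mulr0.
Qed.

Lemma vac_proj_fix p (v : 'M[C]_(D, p)) : (forall k, f k *m v = 0) -> vp *m v = v.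
Proof.
move=> h; elim: (index_enum _) => [|k r IH]; first by rewrite big_nil mul1mx.
rewrite big_cons -[_ * _]/(_ *m _) -mulmxA IH.
by rewrite -[f k *m _]/(_ * _) hf.2 eqxx mulmxBl mul1mx -mulmxA h mulmx0 subr0.
Qed.

Lemma vac_proj_idem : vp * vp = vp.
Proof. by apply: vac_proj_fix => k; apply: car_vac. Qed.

Lemma adj_vac_proj : adj vp = vp.
Proof.
elim: (index_enum _) => [|k r IH]; first by rewrite !big_nil adj1.
rewrite big_cons adjMr IH adjM adjK.
symmetry; apply: (@prod_intertwine _ _ _ _ xpredT) => l _.
have [->//|lk] := eqVneq l k.
rewrite -[X in _ * X]/(f l * adj (f l)) mulrA -car_comm_number// -!mulrA.
congr (_ * _); apply: (can_inj (@adjK _ _ _)).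
by rewrite !adjMr !adjK -[LHS]mulrA; apply: car_comm_number.
Qed.

Lemma car_cr_annihilate p (v : 'M[C]_(D, p)) k (r : seq 'I_M) (P : pred 'I_M) :
  k \notin r -> f k *m v = 0 -> f k *m (\prod_(l <- r | P l) adj (f l) *m v) = 0.
Proof.
move=> kr hv; elim: r kr => [|l r IH]; first by rewrite big_nil mul1mx.
rewrite in_cons negb_or big_cons => /andP[kl /IH h]; case: ifP => // _.
rewrite -[_ * _]/(_ *m _) !mulmxA -[X in X *m _ *m _]/(_ * _) hf.2 (negPf kl) sub0r.
by rewrite !mulNmx -[_ * _]/(_ *m _) -!mulmxA h mulmx0 oppr0.
Qed.

(** Orthonormality of occupation states, compared one mode at a time. A mode in both words contracts
    to 1, since the remaining term annihilates the vacuum; a mode in only one word annihilates the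
    ket or the bra. [vp] keeps all modes while the list shrinks, so the induction closes. *)
Lemma cr_orthogonal (r : seq 'I_M) (P Q : pred 'I_M) : uniq r ->
  vp * adj (\prod_(l <- r | P l) adj (f l)) * (\prod_(l <- r | Q l) adj (f l) * vp)
  = (all (fun l => P l == Q l) r)%:R *: vp.
Proof.
elim: r => [|k r IH]; first by rewrite !big_nil adj1 mul1r mulr1 vac_proj_idem scale1r.
rewrite cons_uniq !big_cons /= => /andP[kr /IH h].
have vP S : f k * (\prod_(l <- r | S l) adj (f l) * vp) = 0.
  by apply: car_cr_annihilate => //; apply: car_vac.
case: (P k) (Q k) => [] [] //=; rewrite ?scale0r.
- rewrite adjMr adjK -h -!mulrA; congr (_ * (_ * _)).
  by rewrite mulrA (hf.2 k k) eqxx mulrBl mul1r -mulrA vP mulr0 subr0.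
- by rewrite adjMr adjK -!mulrA vP !mulr0.
- have hv S : vp * adj (\prod_(l <- r | S l) adj (f l)) * adj (f k) = 0.
    apply: (can_inj (@adjK _ _ _)).
    by rewrite 2!adjMr 2!adjK adj_vac_proj vP adj0.
  by rewrite -[adj _ * _ * vp]mulrA mulrA hv mul0r.
Qed.

Lemma embed_adj X : adj (embed f X) = embed f (adj X).
Proof.
rewrite /embed adj_sum exchange_big; apply: eq_bigr => s _.
rewrite adj_sum; apply: eq_bigr => s' _.
by rewrite adjZ !adjM adjK adj_vac_proj !mxE mulmxA.
Qed.

(** The sandwiched operators multiply like matrix units: by [cr_orthogonal] only row [s'] of [Y]
    survives. *)
Lemma unit_mulr_embed s s' Y :
  (cr s *m vp *m adj (cr s')) * embed f Y
  = \sum_(u < 2 ^ M) Y s' u *: (cr s *m vp *m adj (cr u)).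
Proof.
rewrite mulr_sumr (bigD1 s')//= [X in _ + X]big1 ?addr0 => [|t ts'].
  rewrite mulr_sumr; apply: eq_bigr => u _.
  rewrite -[_ * _]/(_ *m _) -scalemxAr; congr (_ *: _).
  have := @cr_orthogonal (index_enum 'I_M) (occ s') (occ s') (index_enum_uniq _).
  rewrite (introT allP) => [|l _]; last exact/eqP.
  rewrite scale1r => h; rewrite -!mulmxA; congr (_ *m _); rewrite !mulmxA.
  by congr (_ *m _); rewrite -[RHS]h !mulrA.
rewrite mulr_sumr big1// => u _.
rewrite -[_ * _]/(_ *m _) -scalemxAr.
have := @cr_orthogonal (index_enum 'I_M) (occ s') (occ t) (index_enum_uniq _).
case: allP => [h _|_].
  by case/eqP: ts'; apply/esym/occ_inj => l; apply/eqP/h; rewrite mem_index_enum.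
rewrite scale0r => h; rewrite (_ : _ *m _ = 0) ?scaler0//.
transitivity (cr s *m (vp * adj (cr s') * (cr t * vp)) *m adj (cr u)).
  by rewrite -[vp * _ * _]/(vp *m _ *m (_ *m _)) !mulmxA.
by rewrite h mulmx0 mul0mx.
Qed.

Lemma embed_mul X Y : embed f (X *m Y) = embed f X *m embed f Y.
Proof.
rewrite {2}/embed mulmx_suml; apply: eq_bigr => s _.
rewrite mulmx_suml.
under [RHS]eq_bigr => s' _.
  rewrite -scalemxAl -[_ *m embed f Y]/(_ * _) unit_mulr_embed scaler_sumr; over.
rewrite exchange_big; apply: eq_bigr => u _; rewrite mxE scaler_suml.
by apply: eq_bigr => s' _; rewrite scalerA.
Qed.

(** Cyclicity with respect to single ladder operators extends to words in them, and embedded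
    operators are combinations of such words. The class [T] records the operators against which
    cyclicity is available. *)
Lemma embed_tracial (F : 'M[C]_D -> C) (T : 'M[C]_D -> Prop) X :
  {morph F : A B / A + B} -> (forall a A, F (a *: A) = a * F A) ->
  (forall A B, T A -> T B -> T (A * B)) -> T 1 ->
  (forall k, T (f k)) -> (forall k, T (adj (f k))) ->
  (forall k Y, T Y -> F (f k * Y) = F (Y * f k)) ->
  (forall k Y, T Y -> F (adj (f k) * Y) = F (Y * adj (f k))) ->
  F (embed f X) = \tr X * F vp.
Proof.
move=> FD FZ TM T1 Tf Tg hF hFa.
have F0 : F 0 = 0 by rewrite -(scale0r (0 : 'M[C]_D)) FZ mul0r.
have Tprod (I : Type) (r : seq I) (P : pred I) (G : I -> 'M[C]_D) :
    (forall i, P i -> T (G i)) -> T (\prod_(i <- r | P i) G i).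
  by move=> TG; elim/big_ind: _.
have Tcr s : T (cr s) by apply: Tprod.
have Tvp : T vp by apply: Tprod => k _; apply: TM.
have Tadj (r : seq 'I_M) (P : pred 'I_M) : T (adj (\prod_(k <- r | P k) adj (f k))).
  elim: r => [|k r IH]; first by rewrite big_nil adj1.
  by rewrite big_cons; case: ifP => // _; rewrite adjMr adjK; apply: TM.
have Fprod (I : Type) (r : seq I) (P : pred I) (G : I -> 'M[C]_D) Y :
    (forall i, P i -> T (G i)) ->
    (forall i Z, P i -> T Z -> F (G i * Z) = F (Z * G i)) -> T Y ->
    F (\prod_(i <- r | P i) G i * Y) = F (Y * \prod_(i <- r | P i) G i).
  move=> TG FG; elim: r Y => [|i r IH] Y TY; first by rewrite !big_nil mul1r mulr1.
  rewrite !big_cons; case: ifP => Pi; last exact: IH.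
  rewrite -mulrA FG//; last by apply: TM => //; apply: Tprod.
  by rewrite -mulrA IH ?mulrA//; apply: TM => //; apply: TG.
have Fe (s s' : 'I_(2 ^ M)) : F (cr s *m vp *m adj (cr s')) = (s == s')%:R * F vp.
  rewrite -[_ *m _]/(cr s * vp * _) -mulrA Fprod//; last 2 first.
  - by move=> i Z _; apply: hFa.
  - exact: TM.
  (* Doubling [vp] and cycling one copy to the far right sandwiches the two words between vacuum
     projectors, where [cr_orthogonal] evaluates them. *)
  rewrite -vac_proj_idem -2!mulrA Fprod//; last 3 first.
  - by move=> k _; apply: TM.
  - move=> k Z _ TZ; rewrite -[_ *m _]/(_ * _) -mulrA hF; last exact: TM.
    by rewrite -mulrA hFa ?mulrA//; apply: TM.
  - by apply: (TM _ _ Tvp); apply: TM; [apply: Tadj | apply: Tcr].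
  rewrite [in LHS]mulrA -mulrA cr_orthogonal ?index_enum_uniq// FZ.
  rewrite vac_proj_idem; congr (_ *+ _ * _); congr nat_of_bool.
  apply/allP/eqP => [h|-> l _]; last exact/eqP.
  by apply/esym/occ_inj => l; apply/eqP/h; rewrite mem_index_enum.
have Fsum (I : finType) (G : I -> 'M[C]_D) : F (\sum_i G i) = \sum_i F (G i).
  exact: (big_morph F FD F0).
have -> : embed f X = \sum_(s < 2 ^ M) \sum_(s' < 2 ^ M)
    X s s' *: (cr s *m vp *m adj (cr s')) by [].
rewrite Fsum /mxtrace mulr_suml; apply: eq_bigr => s _.
rewrite Fsum (bigD1 s)//= [X in _ + X]big1 ?addr0 => [|s' ss'].
  by rewrite FZ Fe eqxx mul1r.
by rewrite FZ Fe eq_sym (negPf ss') mul0r mulr0.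
Qed.
End Family.
End CanonicalAnticommutation.

(** * Ladder and parity operators in the occupation basis *)

Section LadderOperators.
Variables (R : realType) (M : nat).
Local Notation C := R[i].
Implicit Types (s : 'I_(2 ^ M)) (k l : 'I_M).

(** The label is specified by its bits and not by adding or subtracting a power of 2, so creation
    and annihilation share one formula. The default [s] is never taken, by [occ_flip]. *)
Definition flip k s : 'I_(2 ^ M) :=
  odflt s [pick s' | [forall l, occ s' l == occ s l (+) (l == k)]].

Lemma occ_flip k s l : occ (flip k s) l = occ s l (+) (l == k).
Proof.
rewrite /flip; case: pickP => [s' /forallP/(_ l)/eqP//|h].
(* Labels and bit patterns are equally many, so this injection is onto and the wanted pattern is
   attained. *)
have inj : injective (fun s => [ffun k => occ s k]).
  by move=> s1 s2 /ffunP e; apply: occ_inj => i; have := e i; rewrite !ffunE.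
have [|g _ gK] := inj_card_bij inj.
  by rewrite card_ffun card_bool !card_ord.
set s' := g [ffun l => occ s l (+) (l == k)].
suff : [forall l, occ s' l == occ s l (+) (l == k)] by rewrite (h s').
apply/forallP => i; apply/eqP.
by have /ffunP/(_ i) := gK [ffun l => occ s l (+) (l == k)]; rewrite !ffunE.
Qed.

Lemma flipK k : involutive (flip k).
Proof. by move=> s; apply: occ_inj => l; rewrite !occ_flip -addbA addbb addbF. Qed.

Lemma flipC k l s : flip k (flip l s) = flip l (flip k s).
Proof. by apply: occ_inj => i; rewrite !occ_flip addbAC. Qed.

(** Bit [k] is set, so the subtraction needs no borrow and touches no other bit. *)
Lemma odd_divn_subX (a k l : nat) : odd (a %/ 2 ^ k) ->
  odd ((a - 2 ^ k) %/ 2 ^ l) = odd (a %/ 2 ^ l) (+) (l == k).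
Proof.
move=> ok.
have ka : (2 ^ k <= a)%N.
  by rewrite leqNgt; apply: contraL ok => h; rewrite divn_small.
have e1 : ((a - 2 ^ k) %/ 2 ^ k = a %/ 2 ^ k - 1)%N by rewrite -{1}(mul1n (2 ^ k)%N) divnBMl.
have [lk|kl|->] := ltngtP l k.
- rewrite addbF -{1}(subnKC (ltnW lk)) expnD mulnC divnBMl oddB.
    by rewrite oddX subn_eq0 leqNgt lk addbF.
  by rewrite leq_divRL ?expn_gt0// -expnD subnK// ltnW.
- rewrite addbF -(subnKC (ltnW kl)) expnD !divnMA.
  rewrite e1 -(subnSK kl) expnS !divnMA; congr (odd (_ %/ _)).
  rewrite !divn2 subn1; case: (a %/ 2 ^ k)%N ok => // q /=.
  by rewrite uphalf_half => /negbTE ->.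
- rewrite e1 oddB ?addbT ?ok//.
  by rewrite divn_gt0 ?expn_gt0.
Qed.

Lemma flip_subn k s s' : occ s' k -> (s == (s' - 2 ^ k)%N :> nat) = (s == flip k s').
Proof.
move=> ok; apply/eqP/eqP => [e|->].
  apply: occ_inj => l; rewrite occ_flip /occ e.
  exact: odd_divn_subX.
apply: (@odd_divn_inj M); rewrite ?ltn_ord ?(leq_ltn_trans (leq_subr _ _))// => l lM.
rewrite odd_divn_subX//.
exact: (occ_flip k s' (Ordinal lM)).
Qed.

(** The Jordan-Wigner sign. *)
Definition sgn_below k s : C := (-1) ^+ (\sum_(l < M | (l < k)%N) (occ s l : nat)).

(* [ladder true k] annihilates and [ladder false k] creates in mode k. *)
Definition ladder (b : bool) k : 'M[C]_(2 ^ M) :=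
  \matrix_(s, s') if (occ s' k == b) && (s == flip k s') then sgn_below k s' else 0.

Lemma sgn_below_flip k l s : sgn_below k (flip l s) = (-1) ^+ (l < k)%N * sgn_below k s.
Proof.
rewrite /sgn_below -signr_odd -[in X in _ * X]signr_odd -signr_addb; congr (_ ^+ nat_of_bool _).
have odd_sum (r : seq 'I_M) (P : pred 'I_M) (F : 'I_M -> bool) :
  odd (\sum_(i <- r | P i) F i) = \big[addb/false]_(i <- r | P i) F i.
  by rewrite (big_morph odd oddD (erefl : odd 0 = false)); apply: eq_bigr => i _; rewrite oddb.
rewrite !odd_sum; under eq_bigr => i _ do rewrite occ_flip.
rewrite big_split /= addbC; congr (_ (+) _).
case: (boolP (l < k)%N) => lk; last first.
  by rewrite big1// => i ik; apply/negbTE; apply: contra lk => /eqP <-.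
by rewrite (bigD1 l)//= eqxx big1// => i /andP[_ /negbTE].
Qed.

Lemma sgn_below_sqr k s : sgn_below k s * sgn_below k s = 1.
Proof. by rewrite /sgn_below -expr2 sqrr_sign. Qed.

Lemma annE k : ann R k = ladder true k.
Proof.
apply/matrixP => s s'; rewrite !mxE eqb_id.
by case: (boolP (occ s' k)) => //= ok; rewrite flip_subn.
Qed.

Lemma adj_annE k : adj (ann R k) = ladder false k.
Proof.
rewrite annE; apply/matrixP => s s'; rewrite !mxE eqb_id eqbF_neg.
rewrite (_ : s' == flip k s = (s == flip k s')); last first.
  by rewrite eq_sym (can2_eq (flipK k) (flipK k)).
case: eqP => [->|_]; last by rewrite !andbF conjc0.
rewrite !andbT occ_flip eqxx addbT; case: occ => /=; first by rewrite oppr0.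
rewrite sgn_below_flip ltnn mul1r /sgn_below -signr_odd; case: odd.
  by rewrite expr1 rmorphN rmorph1.
by rewrite expr0 rmorph1.
Qed.

Lemma ladder_mulE b c k l s s' : (ladder b k * ladder c l) s s' =
  if [&& occ s' l == c, occ s' k (+) (k == l) == b & s == flip k (flip l s')]
  then (-1) ^+ (l < k)%N * (sgn_below k s' * sgn_below l s') else 0.
Proof.
rewrite mxE (bigD1 (flip l s'))//= [X in _ + X]big1 ?addr0 => [|u us].
  rewrite !mxE eqxx andbT occ_flip sgn_below_flip.
  case: (occ s' l == c); last by rewrite mulr0.
  by case: (_ == b); case: (s == _); rewrite /= ?mul0r// mulrA.
by rewrite !mxE (negPf us) andbF mulr0.
Qed.

(** Of two distinct modes exactly one lies below the other, so exactly one of the two orders picks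
    up an extra Jordan-Wigner sign. *)
Lemma ladder_anticomm b c k l : k != l -> ladder b k * ladder c l = - (ladder c l * ladder b k).
Proof.
move=> kl; apply/matrixP => s s'; rewrite [RHS]mxE !ladder_mulE (eq_sym l k) (negPf kl) !addbF flipC.
rewrite andbCA; case: ifP => // _; last by rewrite oppr0.
rewrite [sgn_below k s' * _]mulrC -mulNr; congr (_ * _).
have : (k : nat) != l by [].
by case: ltngtP => //= _ _; rewrite ?opprK.
Qed.

Lemma ladder_sqr b k : ladder b k * ladder b k = 0.
Proof.
apply/matrixP => s s'; rewrite ladder_mulE mxE eqxx addbT.
by case: occ; case: b.
Qed.

Lemma ladder_number b k : ladder b k * ladder (~~ b) k
  = diag_mx (\row_s (occ s k != b)%:R).
Proof.
apply/matrixP => s s'; rewrite ladder_mulE !mxE eqxx addbT flipK ltnn mul1r sgn_below_sqr.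
case: (eqVneq s s') => [->|_]; last by rewrite !andbF mulr0n.
by rewrite andbT mulr1n; case: occ; case: b.
Qed.

Lemma ann_car : car (@ann R M).
Proof.
split=> k l; rewrite ?adj_annE !annE.
  by have [->|kl] := eqVneq k l; [rewrite ladder_sqr oppr0 | apply: ladder_anticomm].
have [<-|kl] := eqVneq k l; last by rewrite sub0r; apply: ladder_anticomm.
rewrite (ladder_number true k) (ladder_number false k).
rewrite -[true%:R]/(1%:M); apply/matrixP => s s'; rewrite !mxE.
case: (eqVneq s s') => _; last by rewrite !mulr0n subr0.
by rewrite !mulr1n; case: occ; rewrite /= ?subrr ?subr0.
Qed.

Lemma parityE : parity R M = diag_mx (\row_s (-1) ^+ (occ_parity s)).
Proof.
rewrite /parity (_ : _ *: _ = diag_mx (\row_s Complex 0 (pi * (\sum_(k < M) occ s k)%:R))).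
  rewrite expm_diag; congr diag_mx; apply/rowP => s; rewrite !mxE.
  by rewrite expiMn expi_pi -[LHS]signr_odd.
apply/matrixP => s s'; rewrite mxE summxE.
under eq_bigr => k _ do
  rewrite adj_annE annE -[_ *m _]/(_ * _) (ladder_number false k) !mxE.
rewrite !mxE; case: eqVneq => _; last first.
  by rewrite mulr0n big1 ?mulr0// => k _; rewrite mulr0n.
rewrite [RHS]complex0Z rmorphM mulrA -complex0Z; congr (_ * _).
rewrite rmorph_nat natr_sum; apply: eq_bigr => k _.
by rewrite mulr1n; case: occ.
Qed.

Lemma occ_parity_flip k s : occ_parity (flip k s) = ~~ occ_parity s.
Proof.
rewrite /occ_parity (bigD1 k)//= [X in _ = ~~ odd X](bigD1 k)//= !oddD occ_flip eqxx.
rewrite (eq_bigr (fun i => occ s i : nat)) => [|i ik]; last by rewrite occ_flip (negPf ik) addbF.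
by rewrite addbT; case: (occ s k); rewrite /= ?negbK.
Qed.

Lemma parity_ladder b k : parity R M * ladder b k = - (ladder b k * parity R M).
Proof.
rewrite parityE; apply/matrixP => s s'.
rewrite -[ladder b k * _]/(_ *m _) -[diag_mx _ * _]/(_ *m _) mul_diag_mx [RHS]mxE mul_mx_diag !mxE.
case: ifP => [/andP[_ /eqP ->]|_]; last by rewrite mulr0 mul0r oppr0.
by rewrite occ_parity_flip mulrC; case: occ_parity; rewrite /= ?expr0 ?expr1 ?mulrN ?opprK.
Qed.

Lemma parity_ann k : parity R M * ann R k = - (ann R k * parity R M).
Proof. by rewrite annE parity_ladder. Qed.

Lemma parity_adj_ann k : parity R M * adj (ann R k) = - (adj (ann R k) * parity R M).
Proof. by rewrite adj_annE parity_ladder. Qed.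

Lemma parity_sqr : parity R M * parity R M = 1.
Proof.
rewrite parityE -[_ * _]/(_ *m _) mulmx_diag; apply/matrixP => s s'; rewrite !mxE.
by rewrite -expr2 sqrr_sign.
Qed.

Lemma parity_adj : adj (parity R M) = parity R M.
Proof.
rewrite parityE; apply/matrixP => s s'; rewrite !mxE eq_sym.
case: eqVneq => [->|_]; last by rewrite !mulr0n conjc0.
by case: occ_parity; rewrite !mulr1n ?expr0 ?expr1 ?rmorphN rmorph1.
Qed.

Lemma even_op_parity (X : 'M[C]_(2 ^ M)) :
  X *m parity R M = parity R M *m X -> even_op X.
Proof.
rewrite parityE => /matrixP h s s' ss'; have := h s s'.
rewrite mul_diag_mx mul_mx_diag !mxE => /eqP; rewrite mulrC -subr_eq0 -mulrBl mulf_eq0.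
case/orP => [|/eqP//]; case: occ_parity ss'; case: occ_parity => // _.
  by rewrite expr0 expr1 opprK -[1 + 1]/(2%:R) pnatr_eq0.
by rewrite expr0 expr1 -opprD oppr_eq0 -[1 + 1]/(2%:R) pnatr_eq0.
Qed.

Lemma occ_vac s : (s == 0 :> nat) = [forall k, ~~ occ s k].
Proof.
apply/eqP/forallP => [s0 k|h]; first by rewrite /occ s0 div0n.
apply: (@odd_divn_inj M); rewrite ?expn_gt0// => k kM.
by rewrite div0n; apply/negbTE/(h (Ordinal kM)).
Qed.

Lemma ann_vac k : ann R k *m vac R M = 0.
Proof.
rewrite annE; apply/matrixP => s z; rewrite !mxE big1// => s' _; rewrite !mxE.
case: (boolP (s' == 0 :> nat)) => [|_]; last by rewrite mulr0.
by rewrite occ_vac => /forallP/(_ k)/negPf ->; rewrite mul0r.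
Qed.

Lemma parity_vac : parity R M *m vac R M = vac R M.
Proof.
rewrite parityE; apply/matrixP => s z; rewrite mul_diag_mx !mxE.
case: eqP => [/eqP|_]; last by rewrite mulr0.
rewrite occ_vac /occ_parity => /forallP h; rewrite big1 ?mul1r// => k _.
by rewrite (negPf (h k)).
Qed.

Lemma vac_norm : adj (vac R M) *m vac R M = 1%:M.
Proof.
apply/matrixP => i j; rewrite !mxE !ord1.
have p : (0 < 2 ^ M)%N by rewrite expn_gt0.
rewrite (bigD1 (Ordinal p))//= !mxE eqxx conjc1 mulr1 big1 ?addr0// => s s0.
rewrite !mxE (_ : (s == 0 :> nat) = false) ?conjc0 ?mul0r//.
by apply: contraNF s0 => /eqP e; apply/eqP/val_inj.
Qed.

End LadderOperators.

(** * Commutation between operators placed on time slices *)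

Section Slices.
Variables (R : realType) (L N : nat).
Local Notation C := R[i].
Local Notation D := (2 ^ (N * L))%N.
Implicit Types (t u : 'I_N) (i j : 'I_L) (X Y : 'M[C]_(2 ^ L)).

Lemma car_comp M M' D' (f : 'I_M -> 'M[C]_D') (g : 'I_M' -> 'I_M) :
  injective g -> car f -> car (fun k => f (g k)).
Proof. by move=> gI [h1 h2]; split=> k l; [exact: h1 | rewrite h2 (inj_eq gI)]. Qed.

Lemma mxvec_index_inj m n (i i' : 'I_m) (j j' : 'I_n) :
  (mxvec_index i j == mxvec_index i' j') = (i == i') && (j == j').
Proof.
have [g gK _] := @curry_mxvec_bij m n.
apply/eqP/andP => [h|[/eqP -> /eqP ->]//].
have := gK (i, j) isT; rewrite /= h (gK (i', j') isT) => -[-> ->].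
by rewrite !eqxx.
Qed.

Lemma aH_anti t u i j : aH R t i * aH R u j = - (aH R u j * aH R t i).
Proof. exact: (ann_car R (N * L)).1. Qed.

Lemma aH_car t u i j : aH R t i * adj (aH R u j)
  = ((t == u) && (i == j))%:R - adj (aH R u j) * aH R t i.
Proof. by rewrite /aH (ann_car R (N * L)).2 mxvec_index_inj. Qed.

Lemma slice_car t : car (aH R t : 'I_L -> 'M[C]_D).
Proof.
by split=> i j; [exact: aH_anti | rewrite aH_car eqxx].
Qed.

Lemma slice_adj t X : adj (slice t X) = slice t (adj X).
Proof. exact/embed_adj/slice_car. Qed.

Lemma PH_aH t i : PH R L N * aH R t i = - (aH R t i * PH R L N).
Proof. exact: parity_ann. Qed.

Lemma PH_adj_aH t i : PH R L N * adj (aH R t i) = - (adj (aH R t i) * PH R L N).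
Proof. exact: parity_adj_ann. Qed.

Lemma PH_slice t X : even_op X -> PH R L N * slice t X = slice t X * PH R L N.
Proof.
move=> eX; rewrite [in RHS]/slice -[in RHS](embed_opp (aH R t) eX).
apply: embed_intertwine => i; first by rewrite PH_aH mulNr.
by rewrite PH_adj_aH adjN mulNr.
Qed.

Lemma aH_slice t u i X : t != u -> even_op X ->
  aH R t i * slice u X = slice u X * aH R t i.
Proof.
move=> tu eX; rewrite [in RHS]/slice -[in RHS](embed_opp (aH R u) eX).
apply: embed_intertwine => j; first by rewrite aH_anti mulNr.
by rewrite aH_car (negPf tu) adjN sub0r mulNr.
Qed.

Lemma adj_aH_slice t u i X : t != u -> even_op X ->
  adj (aH R t i) * slice u X = slice u X * adj (aH R t i).
Proof.
move=> tu eX; apply: (can_inj (@adjK _ _ _)); rewrite !adjMr adjK slice_adj.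
symmetry; apply: aH_slice => // s s' ss'; rewrite !mxE eX ?conjc0// eq_sym//.
Qed.

Lemma slice_comm t u X Y : t != u -> even_op X ->
  slice u X * slice t Y = slice t Y * slice u X.
Proof.
move=> tu eX; apply: embed_intertwine => i; first by rewrite aH_slice.
by rewrite adj_aH_slice.
Qed.

End Slices.

(** * The antiperiodic discrete Fourier basis *)

Section Fourier.
Variables (R : realType) (N : nat) (eps : R).
Hypotheses (hN : (0 < N)%N) (heps : 0 < eps).
Local Notation C := R[i].

Lemma conjcM (a b : C) : ((a * b)^*)%C = (a^*)%C * (b^*)%C.
Proof. exact: rmorphM. Qed.

(** The time argument ranges over all naturals so that time [N], one step past the last slice, makes
    sense. *)
Definition fourier (n t : nat) : C :=
  ((Num.sqrt (N%:R : R))^-1)%:C%C * expi (omega N eps n * eps * t%:R).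

Lemma omega_epsE n : omega N eps n * eps = (2 * n + 1)%:R * pi / N%:R.
Proof.
rewrite /omega /Tt invfM [eps^-1 * _]mulrC !mulrA -mulrA mulVf ?mulr1//.
exact: lt0r_neq0.
Qed.

Lemma expi_natpi2 n : expi ((2 * n)%:R * pi) = 1 :> C.
Proof. by rewrite mulrC expiMn expi_pi exprM sqrrN expr1n expr1n. Qed.

(** At a doubled angle the real part differs from 1 by twice the squared sine of [x], which is
    nonzero in this range. *)
Lemma expi_neq1 (x : R) : 0 < `|x| < pi -> expi (x *+ 2) != 1 :> C.
Proof.
move=> hx; apply/eqP => /(congr1 (@complex.Re R)) /= /eqP.
rewrite cos_mulr2n cos2sin2 mulrnBl -subr_eq0.
rewrite (_ : _ - 1 = - (sin x ^+ 2 *+ 2)); last by rewrite mulr2n; ring.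
rewrite oppr_eq0 mulrn_eq0 /= sqrf_eq0 => /eqP s0.
have := sin_gt0_pi hx; case: (ler0P x) => _; rewrite ?sinN s0 ?oppr0 ltxx//.
Qed.

Lemma fourier_conj n m t : fourier n t * ((fourier m t)^*)%C
  = (N%:R)^-1 * expi ((n%:R - m%:R) * pi / N%:R *+ 2) ^+ t.
Proof.
rewrite /fourier conjcM conjc_real conj_expi mulrACA -expiD.
rewrite -rmorphM -invfM -expr2 sqr_sqrtr ?ler0n// fmorphV rmorph_nat; congr (_ * _).
rewrite -expiMn !omega_epsE !(natrD _ (2 * _)%N 1) !natrM; congr expi.
by rewrite -mulNr -mulrDl mulr2n; field; rewrite pnatr_eq0 -lt0n.
Qed.

Lemma fourier_orthonormal (n m : 'I_N) :
  \sum_(t < N) fourier n t * ((fourier m t)^*)%C = (n == m)%:R.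
Proof.
under eq_bigr => t _ do rewrite fourier_conj.
rewrite -mulr_sumr; set z := expi _.
have [nm|nm] := eqVneq n m.
  rewrite /z nm subrr !mul0r mul0rn expi0; under eq_bigr => t _ do rewrite expr1n.
  by rewrite sumr_const card_ord mulVf// pnatr_eq0 -lt0n.
(* Distinct frequencies differ by a multiple of $2\pi/T$, so [z] is an [N]-th root of unity; since
   [n] and [m] differ by less than [N], it is not 1, and the geometric sum vanishes. *)
have zN : z ^+ N = 1.
  rewrite /z -expiMn.
  have -> : ((n%:R - m%:R) * pi / N%:R *+ 2) * N%:R
           = (2 * n)%:R * pi - (2 * m)%:R * pi :> R.
    by rewrite mulr2n !natrM; field; rewrite pnatr_eq0 -lt0n.
  by rewrite expiD -conj_expi !expi_natpi2 conjc1 mulr1.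
have z1 : z != 1.
  apply: expi_neq1; rewrite !normrM normfV !normr_nat (ger0_norm (pi_ge0 R)).
  have N0 : 0 < (N%:R : R) by rewrite ltr0n.
  have d0 : 0 < `|n%:R - m%:R| :> R.
    by rewrite normr_gt0 subr_eq0 eqr_nat.
  have dN : `|n%:R - m%:R| < N%:R :> R.
    have hn : (n%:R : R) < N%:R by rewrite ltr_nat.
    have hm : (m%:R : R) < N%:R by rewrite ltr_nat.
    have hn0 : 0 <= (n%:R : R) by [].
    have hm0 : 0 <= (m%:R : R) by [].
    by rewrite ltr_norml; apply/andP; split; lra.
  by rewrite !mulr_gt0 ?invr_gt0 ?pi_gt0//= ltr_pdivrMr// mulrC ltr_pM2l// pi_gt0.
have /eqP := subrX1 z N; rewrite zN subrr eq_sym mulf_eq0 subr_eq0 (negPf z1) /=.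
by move=> /eqP ->; rewrite mulr0.
Qed.

Lemma fourier_complete (t u : 'I_N) :
  \sum_(n < N) ((fourier n t)^*)%C * fourier n u = (t == u)%:R.
Proof.
pose F : 'M[C]_N := \matrix_(n, t) fourier n t.
have h : F *m adj F = 1%:M.
  apply/matrixP => n m; rewrite !mxE -fourier_orthonormal.
  by apply: eq_bigr => v _; rewrite !mxE.
move: (mulmx1C h) => /matrixP/(_ t u); rewrite !mxE => <-.
by apply: eq_bigr => n _; rewrite !mxE.
Qed.

Lemma expi_fourier n t :
  expi (- (eps * omega N eps n)) * ((fourier n t)^*)%C = ((fourier n t.+1)^*)%C.
Proof.
rewrite /fourier !conjcM !conjc_real !conj_expi mulrCA -expiD.
by congr (_ * expi _); rewrite -addn1 natrD; ring.
Qed.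

(** The frequencies are odd multiples of $\pi/T$, so a full period contributes an odd power of
    -1. *)
Lemma fourier_antiperiodic n : ((fourier n N)^*)%C = - ((fourier n 0)^*)%C.
Proof.
rewrite /fourier !conjcM !conjc_real -mulrN; congr (_ * _).
rewrite omega_epsE mulr0 expi0 conjc1 divfK ?pnatr_eq0 -?lt0n//.
rewrite (natrD _ (2 * _)%N 1) mulrDl mul1r expiD expi_natpi2 expi_pi mul1r.
by rewrite rmorphN rmorph1.
Qed.

End Fourier.

(** * The one-step translation generated by the momentum operator *)

Section Translation.
Variables (R : realType) (L N : nat) (eps : R).
Hypothesis heps : 0 < eps.
Local Notation C := R[i].
Local Notation D := (2 ^ (N.+1 * L))%N.
Local Notation a_ n i := (ahat N.+1 eps n i : 'M[C]_D).
Local Notation w n := (omega N.+1 eps n).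
Local Notation PT := (Pcal L N.+1 eps).
Implicit Types (i j : 'I_L).

Lemma ahatE n i : a_ n i = \sum_(t < N.+1) fourier N.+1 eps n t *: aH R t i.
Proof. by rewrite /ahat scaler_sumr; apply: eq_bigr => t _; rewrite scalerA. Qed.

Lemma aH_ahat (t : 'I_N.+1) i :
  aH R t i = \sum_(n < N.+1) ((fourier N.+1 eps n t)^*)%C *: a_ n i.
Proof.
under eq_bigr => n _ do rewrite ahatE scaler_sumr.
rewrite exchange_big (bigD1 t)//= [X in _ + X]big1 ?addr0 => [|u ut].
  under eq_bigr => n _ do rewrite scalerA.
  by rewrite -scaler_suml fourier_complete// eqxx scale1r.
under eq_bigr => n _ do rewrite scalerA.
by rewrite -scaler_suml fourier_complete// eq_sym (negPf ut) scale0r.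
Qed.

Lemma scale_mulr (D' : nat) (a b : C) (A B : 'M[C]_D') :
  (a *: A) * (b *: B) = (a * b) *: (A * B).
Proof. by rewrite -[LHS]/(_ *m _) -scalemxAl -scalemxAr scalerA. Qed.

Lemma ahat_anti n m i j : a_ n i * a_ m j = - (a_ m j * a_ n i).
Proof.
rewrite !ahatE mulr_suml [in RHS]mulr_sumr -sumrN; apply: eq_bigr => t _.
rewrite mulr_sumr mulr_suml -sumrN; apply: eq_bigr => u _.
by rewrite !scale_mulr aH_anti scalerN mulrC.
Qed.

Lemma ahat_car (n m : 'I_N.+1) i j : a_ n i * adj (a_ m j)
  = ((n == m) && (i == j))%:R - adj (a_ m j) * a_ n i.
Proof.
pose c t u : C := fourier N.+1 eps n t * ((fourier N.+1 eps m u)^*)%C.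
have -> : a_ n i * adj (a_ m j)
    = \sum_(t < N.+1) \sum_(u < N.+1) c t u *: (aH R t i * adj (aH R u j)).
  rewrite !ahatE adj_sum mulr_suml; apply: eq_bigr => t _.
  by rewrite mulr_sumr; apply: eq_bigr => u _; rewrite adjZ scale_mulr.
have -> : adj (a_ m j) * a_ n i
    = \sum_(t < N.+1) \sum_(u < N.+1) c t u *: (adj (aH R u j) * aH R t i).
  rewrite !ahatE adj_sum mulr_sumr; apply: eq_bigr => t _.
  by rewrite mulr_suml; apply: eq_bigr => u _; rewrite adjZ scale_mulr mulrC.
have -> : ((n == m) && (i == j))%:R
    = \sum_(t < N.+1) \sum_(u < N.+1) c t u *: (((t == u) && (i == j))%:R : 'M[C]_D).
  under eq_bigr => t _.
    rewrite (bigD1 t)//= big1 ?addr0 ?eqxx /= => [|u ut]; last first.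
      by rewrite eq_sym (negPf ut) scaler0.
    over.
  rewrite -scaler_suml fourier_orthonormal//.
  by case: (n == m); rewrite ?scale1r ?scale0r.
rewrite -sumrB; apply: eq_bigr => t _; rewrite -sumrB; apply: eq_bigr => u _.
by rewrite -scalerBr aH_car.
Qed.

(** Annihilating mode [m] lowers the momentum by [w m]. The scalar sits inside the right-hand factor
    so that [expm_intertwine] applies and the shift exponentiates to a phase. *)
Lemma Pcal_ahat (m : 'I_N.+1) i : a_ m i * (PT - (w m)%:C%C%:M) = PT * a_ m i.
Proof.
rewrite mulrBr (_ : a_ m i * PT = PT * a_ m i + (w m)%:C%C *: a_ m i); last first.
  (* The commutator is spread as a sum of Kronecker deltas so that both sides can be compared term
     by term. *)
  rewrite /Pcal mulr_sumr mulr_suml -[X in _ + X](_ : \sum_(n < N.+1) \sum_(j < L)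
      ((n == m) && (j == i))%:R * (w n)%:C%C *: a_ n j = _); last first.
    rewrite (bigD1 m)//= [X in _ + X]big1 ?addr0 => [|n nm].
      rewrite (bigD1 i)//= [X in _ + X]big1 ?addr0 => [|j ji]; rewrite ?eqxx ?mul1r//.
      by rewrite (negPf ji) mul0r scale0r.
    by rewrite big1// => j _; rewrite (negPf nm) mul0r scale0r.
  rewrite -big_split /=; apply: eq_bigr => n _; rewrite mulr_sumr mulr_suml.
  rewrite -big_split /=; apply: eq_bigr => j _.
  rewrite -[LHS]/(_ *m _) -[X in _ = X + _]/(_ *m _) -scalemxAr -scalemxAl.
  rewrite [_%:R * _]mulrC -scalerA -scalerDr; congr (_ *: _).
  rewrite -[LHS]/(_ * (_ * _)) -[X in _ = X + _]/(_ * _ * _).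
  rewrite mulrA ahat_car mulrBl -!mulrA (ahat_anti m n i j) mulrN opprK addrC.
  rewrite eq_sym [i == j]eq_sym; congr (_ + _).
  by case: (_ && _); rewrite ?mul1r ?scale1r ?mul0r ?scale0r.
by rewrite -[a_ m i * _%:M]/(_ *m _) mul_mx_scalar addrK.
Qed.

Lemma Pcal_adj : adj PT = PT.
Proof.
rewrite /Pcal adj_sum; apply: eq_bigr => n _; rewrite adj_sum; apply: eq_bigr => j _.
by rewrite adjZ adjM adjK conjc_real.
Qed.

Definition Ut : 'M[C]_D := expm (Complex 0 eps *: PT).

Lemma Ut_ahat (m : 'I_N.+1) i : Ut * a_ m i = expi (- (eps * w m)) *: (a_ m i * Ut).
Proof.
rewrite -[RHS]scale1r -[1]mulr1 -{1}[1]mulr1.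
have h : a_ m i *m expm (Complex 0 eps *: (PT - (w m)%:C%C%:M)) = Ut *m a_ m i.
  apply: expm_intertwine; rewrite -scalemxAr -scalemxAl; congr (_ *: _).
  exact: Pcal_ahat.
rewrite -[LHS]h expm_i_subscalar; last exact: Pcal_adj.
by rewrite -scalemxAr !mulr1 scale1r.
Qed.

(** The result stays in Fourier form because [t.+1] may lie one past the last slice; the interior
    and the wrapping case are both read off from it. *)
Lemma Ut_aH (t : 'I_N.+1) i : Ut * aH R t i
  = (\sum_(n < N.+1) ((fourier N.+1 eps n t.+1)^*)%C *: a_ n i) * Ut.
Proof.
rewrite aH_ahat mulr_sumr mulr_suml; apply: eq_bigr => n _.
rewrite -[LHS]/(_ *m _) -[RHS]/(_ *m _) -scalemxAr -scalemxAl.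
by rewrite -[_ *m a_ n i]/(_ * _) Ut_ahat scalerA mulrC expi_fourier.
Qed.

Lemma Ut_aH_succ (t : 'I_N) i :
  Ut * aH R (widen_ord (leqnSn N) t) i = aH R (lift ord0 t) i * Ut.
Proof. by rewrite Ut_aH [in RHS]aH_ahat. Qed.

Lemma Ut_aH_last i : Ut * aH R ord_max i = - (aH R ord0 i * Ut).
Proof.
rewrite Ut_aH [in RHS]aH_ahat -mulNr -sumrN; congr (_ * _); apply: eq_bigr => n _.
by rewrite fourier_antiperiodic// scaleNr.
Qed.

Lemma Ut_unitaryl : adj Ut * Ut = 1.
Proof. by rewrite /Ut adj_expm_i ?Pcal_adj// -[LHS]/(_ *m _) expm_iVl// Pcal_adj. Qed.

Lemma Ut_unitaryr : Ut * adj Ut = 1.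
Proof. by rewrite /Ut adj_expm_i ?Pcal_adj// -[LHS]/(_ *m _) expm_iVr// Pcal_adj. Qed.

Lemma Ut_adj_intertwine (A B : 'M[C]_D) : Ut * A = B * Ut -> Ut * adj A = adj B * Ut.
Proof.
move=> h; have : A * adj Ut = adj Ut * B.
  by rewrite -[LHS]mul1r -Ut_unitaryl -!mulrA [Ut * _]mulrA h -mulrA Ut_unitaryr mulr1.
by move=> /(congr1 (@adj _ _ _)); rewrite !adjMr adjK.
Qed.

Lemma Ut_slice_succ (t : 'I_N) (X : 'M[C]_(2 ^ L)) :
  Ut * slice (widen_ord (leqnSn N) t) X = slice (lift ord0 t) X * Ut.
Proof.
apply: embed_intertwine => i; first exact: Ut_aH_succ.
exact/Ut_adj_intertwine/Ut_aH_succ.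
Qed.

(** Even operators do not see the antiperiodic sign of their letters. *)
Lemma Ut_slice_last (X : 'M[C]_(2 ^ L)) : even_op X ->
  Ut * slice ord_max X = slice ord0 X * Ut.
Proof.
move=> eX; rewrite [in RHS]/slice -[in RHS](embed_opp (aH R ord0) eX).
have h i : Ut * aH R ord_max i = - aH R ord0 i * Ut by rewrite mulNr Ut_aH_last.
by apply: embed_intertwine => i; rewrite ?h//; apply: Ut_adj_intertwine.
Qed.

Lemma PH_Pcal : PH R L N.+1 * PT = PT * PH R L N.+1.
Proof.
have Pa n i : PH R L N.+1 * a_ n i = - (a_ n i * PH R L N.+1).
  rewrite ahatE mulr_sumr mulr_suml -sumrN; apply: eq_bigr => t _.
  rewrite -[LHS]/(_ *m _) -[X in - X]/(_ *m _) -scalemxAr -scalemxAl -scalerN.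
  by rewrite -[_ *m aH _ _ _]/(_ * _) PH_aH.
have Pad n i : PH R L N.+1 * adj (a_ n i) = - (adj (a_ n i) * PH R L N.+1).
  by apply: (can_inj (@adjK _ _ _)); rewrite adjN !adjMr adjK /PH parity_adj -/(PH R L N.+1) Pa opprK.
rewrite /Pcal mulr_sumr mulr_suml; apply: eq_bigr => n _.
rewrite mulr_sumr mulr_suml; apply: eq_bigr => j _.
rewrite -[LHS]/(_ *m _) -[RHS]/(_ *m _) -scalemxAr -scalemxAl; congr (_ *: _).
rewrite -[LHS]/(_ * (_ * _)) -[RHS]/(_ * _ * _).
by rewrite mulrA Pad mulNr -[adj _ * PH _ _ _ * _]mulrA Pa mulrN opprK mulrA.
Qed.

Lemma PH_Ut : PH R L N.+1 * Ut = Ut * PH R L N.+1.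
Proof.
apply: expm_intertwine; rewrite -scalemxAr -scalemxAl; congr (_ *: _).
exact: PH_Pcal.
Qed.

Lemma ahat_vac n i : a_ n i *m vac R (N.+1 * L) = 0.
Proof.
rewrite ahatE mulmx_suml big1// => t _.
by rewrite -scalemxAl ann_vac scaler0.
Qed.

Lemma Ut_vac : Ut *m vac R (N.+1 * L) = vac R (N.+1 * L).
Proof.
(* The vacuum column intertwines the 1 by 1 zero matrix with the exponent, because the momentum
   annihilates it. *)
rewrite /Ut -(@expm_intertwine _ _ _ _ 0); first by rewrite expm0 mulmx1.
rewrite mulmx0 -scalemxAl /Pcal mulmx_suml big1 ?scaler0// => n _.
rewrite mulmx_suml big1// => j _.
by rewrite -scalemxAl -mulmxA ahat_vac mulmx0 scaler0.
Qed.

End Translation.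

(** * Parity-twisted commutation and cyclicity around the time circle *)

Section Twisted.
Variables (R : realType) (D : nat) (P : 'M[R[i]]_D).
Hypothesis PP : P * P = 1.
Implicit Types (b f Y Z : 'M[R[i]]_D).

(* [b] passes through [Y] up to the fermionic sign of [Y]; this form covers even and odd [Y] at once. *)
Definition twisted b Y : Prop := b * Y = P * Y * P * b.

Lemma twisted1 b : twisted b 1.
Proof. by rewrite /twisted mulr1 mulr1 PP mul1r. Qed.

Lemma twistedM b Y Z : twisted b Y -> twisted b Z -> twisted b (Y * Z).
Proof.
rewrite /twisted => hY hZ; rewrite mulrA hY -mulrA hZ !mulrA.
by rewrite -[P * Y * P * P]mulrA PP mulr1.
Qed.

Lemma twisted_anti b f : b * f = - (f * b) -> P * f = - (f * P) -> twisted b f.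
Proof. by rewrite /twisted => h1 h2; rewrite h2 mulNr -[f * P * P]mulrA PP mulr1 mulNr. Qed.

Lemma twistedV b Y : P * b = - (b * P) -> twisted b Y -> Y * b = b * (P * Y * P).
Proof.
move=> hb h; have hb' : b * P = - (P * b) by rewrite hb opprK.
rewrite !mulrA hb' !mulNr -[P * b * Y]mulrA h !mulrA PP mul1r.
by rewrite -[Y * P * b * P]mulrA hb' mulrN opprK !mulrA -[Y * P * P]mulrA PP mulr1.
Qed.

End Twisted.

Lemma mxtrace_mulrC (R : realType) D (A B : 'M[R[i]]_D) : \tr (A * B) = \tr (B * A).
Proof. exact: mxtrace_mulC. Qed.

Lemma mulr_scalemx (R : realType) D (a : R[i]) (A B : 'M[R[i]]_D) :
  A * (a *: B) = a *: (A * B).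
Proof. by rewrite -[LHS]/(_ *m _) -scalemxAr. Qed.

Lemma mulr_mulmx (R : realType) D p (A B : 'M[R[i]]_D) (v : 'M[R[i]]_(D, p)) :
  (A * B) *m v = A *m (B *m v).
Proof. by rewrite mulmxA. Qed.

Lemma mulr_fix (R : realType) D p (A B : 'M[R[i]]_D) (v : 'M[R[i]]_(D, p)) :
  A *m v = v -> B *m v = v -> (A * B) *m v = v.
Proof. by move=> h1 h2; rewrite mulr_mulmx h2. Qed.

Lemma trace_rank1 (R : realType) D (B : 'M[R[i]]_D) (v : 'cV[R[i]]_D) :
  B *m v = v -> adj v *m v = 1%:M -> \tr (B * (v *m adj v)) = 1.
Proof.
move=> h1 h2; rewrite -[B * _]/(B *m _) mulmxA h1.
by rewrite mxtrace_mulC h2 mxtrace1.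
Qed.

Section TwistedWrap.
Variables (R : realType) (D : nat) (P U : 'M[R[i]]_D).
Hypotheses (PP : P * P = 1) (PU : P * U = U * P).
Local Notation F Y := (\tr (P * U * Y)).

(** Carrying [b'] out past [P] on the left costs one sign, and bringing it back through [Y] from the
    right costs another. The conjugation of [Y] by [P] is absorbed by the cyclic trace, as [U]
    commutes with [P]. *)
Lemma trace_step (b b' Y : 'M[R[i]]_D) : U * b = b' * U -> P * b' = - (b' * P) ->
  twisted P b' Y -> F (b * Y) = F (b' * Y).
Proof.
move=> h1 h2 h3.
have e1 : P * U * (b * Y) = - (b' * (P * U * Y)).
  by rewrite -mulrA [U * (b * Y)]mulrA h1 !mulrA h2 !mulNr.
have e2 : P * U * Y * b' = - (P * U * P * b' * Y * P).
  rewrite -mulrA (twistedV PP h2 h3) !mulrA -[P * U * P * b']mulrA h2 mulrN !mulNr opprK.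
  by rewrite !mulrA.
rewrite e1 linearN /= (mxtrace_mulrC b') e2 linearN opprK /= (mxtrace_mulrC _ P).
by rewrite !mulrA PP mul1r PU.
Qed.

(** [trace_step] turns [b ord0] into [b ord_max]. One more crossing of [U] and [P] returns [b ord0]
    on the far left, the two signs cancelling, and the trace moves it behind [Y]. Since [b ord0]
    itself never crosses [Y], the twisted relation is asked of the other slices only. *)
Lemma trace_wrap N (b : 'I_N.+1 -> 'M[R[i]]_D) (Y : 'M[R[i]]_D) :
  (forall t : 'I_N, U * b (widen_ord (leqnSn N) t) = b (lift ord0 t) * U) ->
  U * b ord_max = - (b ord0 * U) ->
  (forall t, P * b t = - (b t * P)) ->
  (forall t, t != ord0 -> twisted P (b t) Y) ->
  F (b ord0 * Y) = F (Y * b ord0).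
Proof.
move=> hs hl hP hY.
have shift k (hk : (k < N.+1)%N) : F (b ord0 * Y) = F (b (Ordinal hk) * Y).
  elim: k hk => [|k IH] hk.
    by rewrite (_ : Ordinal hk = ord0)//; apply: val_inj.
  have kN : (k < N)%N by [].
  have e1 : widen_ord (leqnSn N) (Ordinal kN) = Ordinal (ltnW hk) by apply: val_inj.
  have e2 : lift ord0 (Ordinal kN) = Ordinal hk by apply: val_inj.
  rewrite (IH (ltnW hk)) -e1 -e2; apply: trace_step => //; exact: hY.
rewrite (shift N (ltnSn N)) (_ : Ordinal _ = ord_max); last exact: val_inj.
have -> : P * U * (b ord_max * Y) = b ord0 * (P * U * Y).
  by rewrite -mulrA [U * (_ * Y)]mulrA hl mulNr mulrN !mulrA hP !mulNr opprK.
by rewrite mxtrace_mulrC !mulrA.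
Qed.

Lemma trace_absorb (q q' A : 'M[R[i]]_D) : U * q = q' * U -> P * q' = q' * P ->
  F (q * A) = F (A * q').
Proof.
move=> h1 h2.
have -> : P * U * (q * A) = q' * (P * U * A).
  by rewrite -mulrA [U * (q * A)]mulrA h1 !mulrA h2.
by rewrite mxtrace_mulrC !mulrA.
Qed.

End TwistedWrap.

(** * The twisted trace of an operator on slice 0 *)

Section TwistedTrace.
Variables (R : realType) (L N : nat) (eps : R).
Hypothesis heps : 0 < eps.
Local Notation C := R[i].
Local Notation D := (2 ^ (N.+1 * L))%N.
Local Notation P := (PH R L N.+1).
Local Notation U := (Ut L N eps).
Local Notation F Y := (\tr (P * U * Y)).

Lemma PH_sqr : P * P = 1.
Proof. exact: parity_sqr. Qed.

Local Notation q t := (\prod_(i < L) (aH R t i *m adj (aH R t i)) : 'M[C]_D).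

Lemma prod_diag_mx n (I : Type) (r : seq I) (d : I -> 'rV[C]_n) :
  \prod_(i <- r) diag_mx (d i) = diag_mx (\row_s \prod_(i <- r) d i 0 s).
Proof.
elim: r => [|i r IH].
  by rewrite big_nil; apply/matrixP => s s'; rewrite !mxE big_nil.
rewrite big_cons IH -[_ * _]/(_ *m _) mulmx_diag; congr diag_mx.
by apply/rowP => s; rewrite !mxE big_cons.
Qed.

Lemma prod_vac_proj : \prod_(t < N.+1) q t = vac R (N.+1 * L) *m adj (vac R (N.+1 * L)).
Proof.
under eq_bigr => t _.
  under eq_bigr => i _ do rewrite /aH adj_annE annE -[_ *m _]/(_ * _) (ladder_number R true).
  rewrite prod_diag_mx; over.
rewrite prod_diag_mx; apply/matrixP => s s'; rewrite !mxE big_ord1 !mxE.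
under eq_bigr => t _ do (rewrite mxE; under eq_bigr => i _ do rewrite mxE).
have [s0|s0] := boolP (s == 0 :> nat); last first.
  rewrite mul0r; move: (s0); rewrite occ_vac negb_forall => /existsP[k].
  rewrite negbK; case/mxvec_indexP: k => t i hk.
  by rewrite (bigD1 t)//= (bigD1 i)//= hk !mul0r mul0rn.
rewrite big1 ?mul1r => [|t _]; last first.
  rewrite big1// => i _; move: s0; rewrite occ_vac => /forallP/(_ (mxvec_index t i)).
  by move=> /negPf ->.
rewrite (_ : s == s' = (s' == 0 :> nat)).
  by case: eqP => _; rewrite ?conjc0 ?conjc1.
by rewrite -(eqP s0) eq_sym.
Qed.

Lemma Ut_vac_proj_succ (t : 'I_N) : U * q (widen_ord (leqnSn N) t) = q (lift ord0 t) * U.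
Proof.
apply: prod_intertwine => i _.
rewrite -[aH _ _ _ *m _]/(_ * _) -[X in _ = X * _]/(_ * _) mulrA Ut_aH_succ// -!mulrA.
by rewrite (Ut_adj_intertwine (Ut_aH_succ heps t i)).
Qed.

Lemma PH_vac_proj t : P * q t = q t * P.
Proof.
apply: prod_intertwine => i _.
rewrite -[aH _ _ _ *m _]/(_ * _) mulrA PH_aH mulNr -[X in - X]mulrA PH_adj_aH mulrN opprK.
by rewrite mulrA.
Qed.

Lemma vac_proj_comm t u : q t * q u = q u * q t.
Proof.
have qE v : exists d, q v = diag_mx d.
  under eq_bigr => i _ do rewrite /aH adj_annE annE -[_ *m _]/(_ * _) (ladder_number R true).
  by rewrite prod_diag_mx; eexists.
have [d ->] := qE t; have [e ->] := qE u.
by rewrite -[LHS]/(_ *m _) -[RHS]/(_ *m _) diag_mxC.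
Qed.

Lemma vac_proj_vac t : q t *m vac R (N.+1 * L) = vac R (N.+1 * L).
Proof. by apply: vac_proj_fix => [|i]; [exact: slice_car | exact: ann_vac]. Qed.

(* [U q_t = q_{t+1} U] and cyclicity let the trace absorb the vacuum projectors of all slices, one at a time. *)
Lemma trace_vac_proj : F (q ord0) = 1.
Proof.
have absorb k (hk : (k < N.+1)%N) : exists A : 'M[C]_D,
    [/\ F (q ord0) = F A, A *m vac R (N.+1 * L) = vac R (N.+1 * L),
       (forall t, A * q t = q t * A) &
       forall t : 'I_N.+1, (t <= k)%N -> A * q t = A].
  elim: k hk => [|k IH] hk.
    exists (q ord0); split=> //; [exact: vac_proj_vac| by move=> t; apply: vac_proj_comm|].
    move=> t; rewrite leqn0 => /eqP t0; rewrite (_ : t = ord0); last exact: val_inj.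
    by apply: vac_proj_idem; apply: slice_car.
  have [A [h1 h2 h3 h4]] := IH (ltnW hk); have kN : (k < N)%N by [].
  pose t1 := lift ord0 (Ordinal kN).
  exists (A * q t1); split.
  - rewrite h1 -{1}(h4 (widen_ord (leqnSn N) (Ordinal kN)))// h3.
    by apply: trace_absorb; [exact: Ut_vac_proj_succ | exact: PH_vac_proj].
  - by rewrite mulr_mulmx vac_proj_vac.
  - by move=> t; rewrite mulrA -h3 -!mulrA vac_proj_comm.
  - move=> t; rewrite leq_eqVlt => /orP[/eqP e|tk]; last first.
      by rewrite -mulrA vac_proj_comm mulrA h4.
    rewrite (_ : t = t1); last exact: val_inj.
    by rewrite -mulrA vac_proj_idem//; apply: slice_car.
have [A [-> h2 _ h4]] := absorb N (ltnSn N).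
(* The product over all slices has rank one; as [P], the translation and [A] all fix the vacuum, the
   trace is its squared norm. *)
have -> : A = A * \prod_(t < N.+1) q t.
  elim: (index_enum _) => [|t r IH]; first by rewrite big_nil mulr1.
  by rewrite big_cons mulrA h4// -ltnS ltn_ord.
rewrite prod_vac_proj mulrA; apply: trace_rank1; last exact: vac_norm.
by apply: mulr_fix => //; apply: mulr_fix; [exact: parity_vac | exact: Ut_vac].
Qed.

Lemma trace_Ut_slice0 (X : 'M[C]_(2 ^ L)) : F (slice ord0 X) = \tr X.
Proof.
(* The operator carried round the circle becomes a ladder operator of every other slice in turn; [T]
   collects the [Y] it can meet there, including the odd operators of slice 0. *)
pose T (Y : 'M[C]_D) := forall t i, t != ord0 ->
  twisted P (aH R t i) Y /\ twisted P (adj (aH R t i)) Y.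
rewrite (embed_tracial (slice_car R L ord0) (F := fun Y => F Y) (T := T)).
- by rewrite trace_vac_proj mulr1.
- by move=> A B; rewrite mulrDr linearD.
- by move=> a A; rewrite mulr_scalemx mxtraceZ.
- by move=> A B TA TB t i t0; split; apply: twistedM; rewrite ?PH_sqr//;
    have [] := TA t i t0; have [] := TB t i t0.
- by move=> t i _; split; apply: twisted1; apply: PH_sqr.
- move=> k t i t0; split; apply: twisted_anti; rewrite ?PH_sqr ?PH_aH//.
    exact: aH_anti.
  have := aH_car R ord0 t k i; rewrite eq_sym (negPf t0) sub0r => ->.
  by rewrite opprK.
- move=> k t i t0; split; apply: twisted_anti; rewrite ?PH_sqr ?PH_adj_aH//.
    by rewrite aH_car (negPf t0) sub0r.
  by apply: (can_inj (@adjK _ _ _)); rewrite adjN !adjMr !adjK aH_anti.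
- move=> k Y TY; apply: (trace_wrap PH_sqr (PH_Ut L N eps) (b := fun t => aH R t k)).
  + by move=> t; apply: Ut_aH_succ.
  + exact: Ut_aH_last.
  + by move=> t; apply: PH_aH.
  + by move=> t t0; have [] := TY t k t0.
- move=> k Y TY; apply: (trace_wrap PH_sqr (PH_Ut L N eps) (b := fun t => adj (aH R t k))).
  + by move=> t; apply: Ut_adj_intertwine => //; apply: Ut_aH_succ.
  + rewrite -mulNr -adjN; apply: Ut_adj_intertwine => //.
    by rewrite mulNr; apply: Ut_aH_last.
  + by move=> t; apply: PH_adj_aH.
  + by move=> t t0; have [] := TY t k t0.
Qed.

End TwistedTrace.

(** * The maximally entangled vector turns expectation values into traces *)

Section MaximallyEntangled.
Variable R : realType.
Local Notation C := R[i].

(** Commutation with [b] acts on the exponential as a derivation: its commutator with [A] is [c],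
    which commutes with [A], and [b] itself annihilates [v]. *)
Lemma expm_ladder D p (A b c : 'M[C]_D) (v : 'M[C]_(D, p)) :
  b * A = A * b + c -> c * A = A * c -> b *m v = 0 ->
  b *m (expm A *m v) = c *m (expm A *m v).
Proof.
move=> h1 h2 h3.
have hX k : b * A ^+ k.+1 = A ^+ k.+1 * b + (A ^+ k * c) *+ k.+1.
  elim: k => [|k IH]; first by rewrite expr1 expr0 mul1r h1.
  rewrite [A ^+ k.+2]exprSr mulrA IH mulrDl -[A ^+ k.+1 * b * A]mulrA h1 mulrDr.
  rewrite [A ^+ k.+1 * (A * b)]mulrA -addrA.
  congr (_ + _); rewrite mulrnAl -[A ^+ k * c * A]mulrA h2.
  by rewrite [A ^+ k * (A * c)]mulrA -exprSr [RHS]mulrS.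
(* The derivation lowers the degree by one, hence [m.+1] against [m]; the factor [k.+1] it produces
   reduces the factorial. *)
have hS m : b *m (expm_psum A m.+1 *m v) = expm_psum A m *m (c *m v).
  rewrite /expm_psum !mulmx_suml mulmx_sumr big_ord_recl expr0 -scalemxAl mul1mx.
  rewrite -scalemxAr h3 scaler0 add0r; apply: eq_bigr => k _.
  have e : b *m (A ^+ lift ord0 k *m v) = k.+1%:R *: (A ^+ k *m (c *m v)).
    rewrite mulmxA -[b *m _]/(b * _) /lift /= /bump /= add1n hX mulmxDl.
    rewrite mulr_mulmx h3 mulmx0 add0r -scaler_nat -scalemxAl.
    by rewrite mulr_mulmx.
  rewrite -!scalemxAl -scalemxAr e scalerA; congr (_ *: _).
  rewrite /lift /= /bump /= add1n factS natrM.
  by rewrite invfM mulrAC mulVf ?mul1r//.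
transitivity (expm A *m (c *m v)); last first.
  rewrite !mulmxA; congr (_ *m _); symmetry; exact: expm_intertwine.
have cv : mcvg (fun m => b *m (expm_psum A m *m v)) (b *m (expm A *m v)).
  exact/mcvg_mull/mcvg_mulr/expm_psum_cvg.
apply: mcvg_unique (mcvg_shift cv) _.
rewrite (_ : (fun _ => _) = (fun m => expm_psum A m *m (c *m v))).
  exact/mcvg_mulr/expm_psum_cvg.
by apply/funext => m; apply: hS.
Qed.

Lemma comm_mul_fix D p (X Y : 'M[C]_D) (v : 'M[C]_(D, p)) :
  X *m Y = Y *m X -> X *m v = v -> X *m (Y *m v) = Y *m v.
Proof. by move=> h1 h2; rewrite mulmxA h1 -mulmxA h2. Qed.

Lemma vac_expectation D (p : 'M[C]_D) (Phi v : 'cV[C]_D) :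
  adj p = p -> p * p = p -> p *m Phi = v -> adj v *m v = 1%:M ->
  (adj Phi *m p *m Phi) 0 0 = 1.
Proof.
move=> h1 h2 h3 h4; rewrite -h2 -[p * p]/(p *m p) mulmxA -[adj Phi *m p *m p *m Phi]mulmxA h3.
by rewrite -{1}h1 -adjM h3 h4 mxE eqxx.
Qed.

Lemma adj_anti D (X Y : 'M[C]_D) : X * Y = - (Y * X) -> adj X * adj Y = - (adj Y * adj X).
Proof. by move=> h; rewrite -!adjMr h adjN opprK. Qed.

(* [<Phi| . |Phi>] is cyclic on the system algebra: an operator [s k] on the left is moved onto the bra,
   becomes an environment operator there, passes through [Y], and is turned back by the ket. *)
Lemma entangled_trace M D (P : 'M[C]_D) (s e : 'I_M -> 'M[C]_D) (Phi : 'cV[C]_D) X :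
  P * P = 1 -> adj P = P -> P *m Phi = Phi -> car s ->
  (forall k l, s k * e l = - (e l * s k)) ->
  (forall k l, s k * adj (e l) = - (adj (e l) * s k)) ->
  (forall k, P * s k = - (s k * P)) ->
  (forall k, P * adj (s k) = - (adj (s k) * P)) ->
  (forall k, s k *m Phi = adj (e k) *m Phi) ->
  (forall k, e k *m Phi = - (adj (s k) *m Phi)) ->
  (adj Phi *m (\prod_(k < M) (s k *m adj (s k))) *m Phi) 0 0 = 1 ->
  (adj Phi *m embed s X *m Phi) 0 0 = \tr X.
Proof.
move=> PP Padj PPhi scar se sea Ps Psa sPhi ePhi Fvp.
have PhiaP : adj Phi *m P = adj Phi by rewrite -{2}PPhi adjM Padj.
pose T (Y : 'M[C]_D) := forall k, twisted P (e k) Y /\ twisted P (adj (e k)) Y.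
have eas k l : e k * adj (s l) = - (adj (s l) * e k).
  by apply: (can_inj (@adjK _ _ _)); rewrite adjN !adjMr !adjK sea.
(* After crossing [Y], the environment operator [b] meets the ket and becomes the system operator
   [Z]. The bra absorbs one [P]; the other must cross [Z] before the ket absorbs it, which gives the
   sign. *)
have PhiP (Y Z : 'M[C]_D) b : twisted P b Y -> P * Z = - (Z * P) ->
    b *m Phi = Z *m Phi -> adj Phi *m (b * Y) *m Phi = - (adj Phi *m (Y * Z) *m Phi).
  move=> h hZ hb; rewrite h -[P * Y * P * b]/(P *m Y *m P *m b) !mulmxA PhiaP.
  rewrite -[_ *m b *m _]mulmxA hb mulmxA -[adj Phi *m Y *m P *m Z]mulmxA.
  rewrite -[P *m Z]/(P * Z) hZ mulmxN mulNmx -[Z * P]/(Z *m P) mulmxA.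
  by rewrite -[_ *m P *m Phi]mulmxA PPhi.
rewrite (embed_tracial scar (F := fun Y => (adj Phi *m Y *m Phi) 0 0) (T := T)).
- by rewrite Fvp mulr1.
- by move=> X1 X2; rewrite mulmxDr mulmxDl mxE.
- by move=> a X1; rewrite -scalemxAr -scalemxAl mxE.
- by move=> X1 X2 T1 T2 k; have [? ?] := T1 k; have [? ?] := T2 k; split; apply: twistedM.
- by move=> k; split; apply: twisted1.
- by move=> k l; split; apply: twisted_anti => //; rewrite ?se ?sea opprK.
- move=> k l; split; apply: twisted_anti => //.
  by rewrite (adj_anti (se k l)) opprK.
- move=> k Y TY.
  have -> : adj Phi *m (s k * Y) *m Phi = - (adj Phi *m (adj (e k) * Y) *m Phi).
    have h : adj Phi *m s k = - (adj Phi *m adj (e k)).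
      by apply: (can_inj (@adjK _ _ _)); rewrite adjN !adjM !adjK ePhi opprK.
    rewrite -[s k * Y]/(_ *m _) -[adj (e k) * Y]/(_ *m _) !mulmxA h.
    by rewrite !mulNmx.
  by rewrite (PhiP Y (s k)) ?opprK//; have [] := TY k.
- move=> k Y TY.
  have -> : adj Phi *m (adj (s k) * Y) *m Phi = adj Phi *m (e k * Y) *m Phi.
    have h : adj Phi *m adj (s k) = adj Phi *m e k.
      by apply: (can_inj (@adjK _ _ _)); rewrite !adjM !adjK sPhi.
    by rewrite -[adj (s k) * Y]/(_ *m _) -[e k * Y]/(_ *m _) !mulmxA h.
  rewrite (PhiP Y (- adj (s k))); first by rewrite mulrN mulmxN mulNmx opprK.
  + by have [] := TY k.
  + by rewrite mulrN mulNr Psa.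
  + by rewrite ePhi mulNmx.
Qed.

Variables L N : nat.
Local Notation M := (N * L)%N.
Local Notation D := (2 ^ (M + M))%N.
Local Notation s_ k := (ann R (lshift M k) : 'M[C]_D).
Local Notation e_ k := (ann R (rshift M k) : 'M[C]_D).
Local Notation P := (parity R (M + M)).
Local Notation Phi := (PhiPlus R L N).
Local Notation v0 := (vac R (M + M)).
Local Notation A := (\sum_(k < M) adj (s_ k) * adj (e_ k) : 'M[C]_D).

Lemma sys_car : car (fun k => s_ k).
Proof. exact/car_comp/ann_car/lshift_inj. Qed.

Lemma env_car : car (fun k => e_ k).
Proof. exact/car_comp/ann_car/rshift_inj. Qed.

Lemma sys_env k l : s_ k * e_ l = - (e_ l * s_ k).
Proof. exact: (ann_car R (M + M)).1. Qed.

Lemma sys_adj_env k l : s_ k * adj (e_ l) = - (adj (e_ l) * s_ k).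
Proof. by rewrite (ann_car R (M + M)).2 eq_lrshift sub0r. Qed.

Lemma env_adj_sys k l : e_ k * adj (s_ l) = - (adj (s_ l) * e_ k).
Proof. by rewrite (ann_car R (M + M)).2 eq_rlshift sub0r. Qed.

Lemma PhiPlusE : Phi = expm A *m v0.
Proof.
apply: (congr1 (fun X : 'M[C]_D => expm X *m v0)).
rewrite pair_big; rewrite [RHS](reindex _ (curry_mxvec_bij N L)).
by apply: eq_bigr => -[t j] _.
Qed.

Lemma ann_PhiPlus (b c : 'M[C]_D) :
  b * A = A * b + c -> c * A = A * c -> b *m v0 = 0 -> b *m Phi = c *m Phi.
Proof. by rewrite PhiPlusE; apply: expm_ladder. Qed.

Lemma sum_delta (k : 'I_M) (F : 'I_M -> 'M[C]_D) :
  \sum_(l < M) (k == l)%:R * F l = F k.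
Proof.
rewrite (bigD1 k)//= eqxx mul1r big1 ?addr0// => l lk.
by rewrite eq_sym (negPf lk) mul0r.
Qed.

Lemma sys_PhiPlus k : s_ k *m Phi = adj (e_ k) *m Phi.
Proof.
apply: ann_PhiPlus; last exact: ann_vac.
  rewrite -(sum_delta k (fun l => adj (e_ l))) mulr_sumr mulr_suml -big_split /=.
  apply: eq_bigr => l _; rewrite mulrA sys_car.2 mulrBl addrC; congr (_ + _).
  by rewrite -!mulrA sys_adj_env mulrN opprK.
rewrite mulr_sumr mulr_suml; apply: eq_bigr => l _.
rewrite mulrA -[adj (e_ k) * _]opprK -(adj_anti (sys_env l k)) mulNr.
by rewrite -!mulrA (adj_anti (env_car.1 k l)) mulrN opprK.
Qed.

(** The sign, absent from [sys_PhiPlus], arises because [e_ k] crosses the system creator before it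
    meets its own adjoint. *)
Lemma env_PhiPlus k : e_ k *m Phi = - (adj (s_ k) *m Phi).
Proof.
rewrite -mulNmx; apply: ann_PhiPlus; last exact: ann_vac.
  rewrite -(sum_delta k (fun l => adj (s_ l))) -sumrN mulr_sumr mulr_suml -big_split /=.
  apply: eq_bigr => l _; rewrite mulrA env_adj_sys mulNr -[X in - X]mulrA (env_car.2 k l).
  rewrite mulrBr opprB -!mulrA; congr (_ - _).
  by case: (k == l); rewrite ?mulr1 ?mul1r ?mulr0 ?mul0r.
rewrite mulNr mulrN; congr (- _).
rewrite mulr_sumr mulr_suml; apply: eq_bigr => l _.
rewrite mulrA (adj_anti (sys_car.1 k l)) mulNr.
by rewrite -!mulrA (adj_anti (sys_env k l)) mulrN opprK.
Qed.

Lemma parity_PhiPlus : P *m Phi = Phi.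
Proof.
have h : P *m expm A = expm A *m P.
  apply: expm_intertwine.
  rewrite -[LHS]/(_ * _) -[RHS]/(_ * _) mulr_sumr mulr_suml; apply: eq_bigr => l _.
  rewrite mulrA parity_adj_ann mulNr -[X in - X]mulrA parity_adj_ann mulrN opprK.
  by rewrite mulrA.
by rewrite PhiPlusE; apply: comm_mul_fix h (parity_vac R (M + M)).
Qed.

Local Notation F Y := ((adj Phi *m Y *m Phi) 0 0).
Local Notation vp := (\prod_(k < M) (s_ k *m adj (s_ k))).

(** [vp] annihilates every system creator standing on its right, so only the constant term of the
    exponential survives. *)
Lemma PhiPlus_vac_proj : F vp = 1.
Proof.
have vs k : vp * adj (s_ k) = 0.
  by apply: (can_inj (@adjK _ _ _)); rewrite adjMr adjK adj0 (adj_vac_proj sys_car);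
    apply: (car_vac sys_car k).
have hA : vp *m A = 0 *m vp.
  rewrite mul0mx -[LHS]/(_ * _) mulr_sumr big1// => k _.
  by rewrite mulrA vs mul0r.
have h0 : vp *m v0 = v0 by apply: (vac_proj_fix sys_car) => k; apply: ann_vac.
have h : vp *m Phi = v0.
  by rewrite PhiPlusE mulmxA (expm_intertwine hA) expm0 mul1mx.
exact: (vac_expectation (adj_vac_proj sys_car) (vac_proj_idem sys_car) h (vac_norm R (M + M))).
Qed.

Lemma PhiPlus_liftHK (X : 'M[C]_(2 ^ M)) : F (liftHK X) = \tr X.
Proof.
apply: (@entangled_trace _ _ P (fun k => s_ k) (fun k => e_ k) Phi).
- exact: parity_sqr.
- exact: parity_adj.
- exact: parity_PhiPlus.
- exact: sys_car.
- exact: sys_env.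
- exact: sys_adj_env.
- by move=> k; apply: parity_ann.
- by move=> k; apply: parity_adj_ann.
- exact: sys_PhiPlus.
- exact: env_PhiPlus.
- exact: PhiPlus_vac_proj.
Qed.

End MaximallyEntangled.

(** * Algebraic identities for traces, conjugations and rank-one projectors *)

Section TraceIdentities.
Variable R : realType.
Local Notation C := R[i].

Lemma prod_unitary D (I : Type) (r : seq I) (F : I -> 'M[C]_D) :
  (forall i, adj (F i) * F i = 1) ->
  adj (\prod_(i <- r) F i) * \prod_(i <- r) F i = 1.
Proof.
move=> h; elim: r => [|i r IH]; first by rewrite big_nil adj1 mulr1.
by rewrite big_cons adjMr -mulrA [adj (F i) * _]mulrA h mul1r.
Qed.

Lemma prod_mul_comm D (I : Type) (r : seq I) (F G : I -> 'M[C]_D) :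
  (forall i j, G i * F j = F j * G i) ->
  \prod_(i <- r) (F i * G i) = \prod_(i <- r) F i * \prod_(i <- r) G i.
Proof.
move=> h; elim: r => [|i r IH]; first by rewrite !big_nil mulr1.
rewrite !big_cons IH -!mulrA; congr (_ * _); rewrite !mulrA; congr (_ * _).
by apply: (@prod_intertwine R D (G i) I r xpredT F F) => j _; apply: h.
Qed.

(** Translation brings to slice [t+1] an evolution by [eps t], one step short of what [V] has there;
    these deficits are the factors [E t (- eps)]. The evolution by [eps N] from the last slice lands
    on slice 0, where [V] is trivial, and it equals [eps N.+1] less one step. *)
Lemma translation_conjugation D N (eps : R) (U : 'M[C]_D) (E : 'I_N.+1 -> R -> 'M[C]_D) :
  (forall t x y, E t (x + y) = E t x * E t y) -> (forall t, E t 0 = 1) ->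
  (forall t x, adj (E t x) * E t x = 1) ->
  (forall t u x y, E t x * E u y = E u y * E t x) ->
  (forall (t : 'I_N) x, U * E (widen_ord (leqnSn N) t) x = E (lift ord0 t) x * U) ->
  (forall x, U * E ord_max x = E ord0 x * U) ->
  let V := \prod_(t < N.+1) E t (eps * t%:R) in
  adj V * U * V = E ord0 (eps * N.+1%:R) * (U * \prod_(t < N.+1) E t (- eps)).
Proof.
move=> ED E0 Eu Ec Us Ul V.
pose W := \prod_(t < N) E (lift ord0 t) (eps * t.+1%:R).
pose Z := \prod_(t < N) E (lift ord0 t) (- eps).
have VW : V = W.
  rewrite /V big_ord_recl mulr0 E0 mul1r; apply: eq_bigr => t _.
  by rewrite lift0.
have WW : adj W * W = 1 by apply: prod_unitary => t; apply: Eu.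
have WZ : \prod_(t < N) E (lift ord0 t) (eps * t%:R) = W * Z.
  rewrite -prod_mul_comm => [|t u]; last exact: Ec.
  apply: eq_bigr => t _; rewrite -ED; congr (E _ _).
  by rewrite -addn1 natrD; ring.
have UV : U * V = W * Z * E ord0 (eps * N%:R) * U.
  rewrite /V big_ord_recr mulrA.
  rewrite (@prod_intertwine _ _ U _ _ xpredT _ (fun t : 'I_N => E (lift ord0 t) (eps * t%:R))).
    by rewrite WZ -mulrA Ul mulrA.
  by move=> t _; apply: Us.
have UZ : U * \prod_(t < N.+1) E t (- eps) = Z * E ord0 (- eps) * U.
  rewrite big_ord_recr mulrA.
  rewrite (@prod_intertwine _ _ U _ _ xpredT _ (fun t : 'I_N => E (lift ord0 t) (- eps))).
    by rewrite -mulrA Ul mulrA.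
  by move=> t _; apply: Us.
have EZ : E ord0 (eps * N.+1%:R) * Z = Z * E ord0 (eps * N.+1%:R).
  by apply: prod_intertwine => t _; apply: Ec.
rewrite -mulrA UV {1}VW UZ !mulrA WW mul1r EZ; congr (_ * _).
rewrite -mulrA -ED; congr (_ * E _ _).
by rewrite -addn1 natrD; ring.
Qed.

Lemma trace_half_square D (P Q U2 S O : 'M[C]_D) :
  U2 * U2 = S -> P * U2 = U2 * P -> P * Q = Q * P ->
  \tr (P * U2 * O * Q * U2) = \tr (P * Q * S * O).
Proof.
move=> hS hU hQ; rewrite mxtrace_mulrC.
have -> : U2 * (P * U2 * O * Q) = P * S * O * Q by rewrite !mulrA -hU -hS !mulrA.
by rewrite mxtrace_mulrC !mulrA hQ.
Qed.

Lemma trace_half_square1 D (P Q U2 S : 'M[C]_D) :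
  U2 * U2 = S -> P * U2 = U2 * P -> P * Q = Q * P ->
  \tr (P * U2 * Q * U2) = \tr (P * Q * S).
Proof. by move=> hS hU hQ; have := trace_half_square 1 hS hU hQ; rewrite !mulr1. Qed.

Lemma trace_conjugated D (P Q U V : 'M[C]_D) :
  adj V * V = 1 -> P * V = V * P -> Q * V = V * Q -> P * U = U * P ->
  \tr (P * Q * (adj V * U * V)) = \tr (P * U * Q).
Proof.
move=> VV PV QV PU.
have VV' : V * adj V = 1 by apply: mulmx1C.
have -> : P * Q * (adj V * U * V) = P * Q * adj V * U * V by rewrite !mulrA.
rewrite mxtrace_mulrC.
have -> : V * (P * Q * adj V * U) = P * Q * U.
  by rewrite !mulrA -PV -[P * V * Q]mulrA -QV !mulrA -[P * Q * V * _]mulrA VV' mulr1.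
have -> : P * Q * U = P * (Q * U) by rewrite mulrA.
rewrite mxtrace_mulrC -mulrA mxtrace_mulrC.
by rewrite -PU.
Qed.

Lemma conjugated_half_square D (V Eh U : 'M[C]_D) :
  adj V * V = 1 -> Eh * Eh = U -> (adj V * Eh * V) * (adj V * Eh * V) = adj V * U * V.
Proof.
move=> VV <-; have VV' : V * adj V = 1 by apply: mulmx1C.
have -> : adj V * Eh * V * (adj V * Eh * V) = adj V * Eh * (V * adj V) * Eh * V by rewrite !mulrA.
by rewrite VV' mulr1 !mulrA.
Qed.

(** Every claim comes down to the scalar [adj B *m Psi], by which the operator is normalised. *)
Lemma rank1_projector D (Psi B : 'cV[C]_D) :
  let ov := (adj B *m Psi) 0 0 in let Rk := ov^-1 *: (Psi *m adj B) in
  ov != 0 -> [/\ Rk *m Rk = Rk, \tr Rk = 1 &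
    forall Y, \tr (Rk *m Y) = ov^-1 * (adj B *m Y *m Psi) 0 0].
Proof.
move=> ov Rk ov0.
have trY Y : \tr (Rk *m Y) = ov^-1 * (adj B *m Y *m Psi) 0 0.
  rewrite /Rk -scalemxAl mxtraceZ; congr (_ * _).
  by rewrite -[in LHS]mulmxA [LHS]mxtrace_mulC; apply: trace_mx11.
split=> //; last by rewrite -[Rk]mulmx1 trY mulmx1 mulVf.
rewrite /Rk -scalemxAl -scalemxAr -mulmxA [adj B *m _]mulmxA.
have -> : adj B *m Psi = ov%:M by rewrite [LHS]mx11_scalar.
by rewrite mul_scalar_mx -scalemxAr scalerA mulVf// scale1r.
Qed.

Lemma bracket D (A B Y A' B' : 'M[C]_D) (Phi : 'cV[C]_D) :
  adj (adj (A *m B) *m Phi) *m Y *m (A' *m B' *m Phi)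
  = adj Phi *m (A *m B *m Y *m A' *m B') *m Phi.
Proof. by rewrite adjM adjK !mulmxA. Qed.

Lemma bracket1 D (A B A' B' : 'M[C]_D) (Phi : 'cV[C]_D) :
  adj (adj (A *m B) *m Phi) *m (A' *m B' *m Phi)
  = adj Phi *m (A *m B *m A' *m B') *m Phi.
Proof. by rewrite adjM adjK !mulmxA. Qed.

Lemma expm_iC D (A : 'M[C]_D) (x y : R) : adj A = A ->
  expm (Complex 0 x *: A) * expm (Complex 0 y *: A)
  = expm (Complex 0 y *: A) * expm (Complex 0 x *: A).
Proof.
move=> hA; transitivity (expm (Complex 0 (x + y) *: A)).
  by symmetry; apply: expm_iD.
by rewrite addrC; apply: expm_iD.
Qed.

Lemma expm_i_halfsqr D (A : 'M[C]_D) (x : R) : adj A = A ->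
  expm (Complex 0 (x / 2) *: A) * expm (Complex 0 (x / 2) *: A)
  = expm (Complex 0 x *: A).
Proof. by move=> hA; rewrite [in RHS](splitr x); symmetry; apply: expm_iD. Qed.

Lemma conjugated_comm D (P V E : 'M[C]_D) : adj P = P ->
  P * V = V * P -> P * E = E * P -> P * (adj V * E * V) = adj V * E * V * P.
Proof.
move=> Pa h1 h3.
have h2 : P * adj V = adj V * P.
  by have := congr1 (@adj _ _ _) h1; rewrite !adjMr Pa.
by rewrite !mulrA h2 -[adj V * P * _]mulrA h3 !mulrA -[_ * P * V]mulrA h1 !mulrA.
Qed.

End TraceIdentities.

(** * The quantum action, its square root and the numerator and denominator *)

Section DensityMatrix.
Variables (R : realType) (L N : nat) (eps : R) (H rho : 'M[R[i]]_(2 ^ L)).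
Hypotheses (heps : 0 < eps) (Hadj : adj H = H) (Heven : even_op H) (rhoeven : even_op rho).
Local Notation C := R[i].
Local Notation D := (2 ^ (N.+1 * L))%N.
Local Notation P := (PH R L N.+1).
Local Notation PT := (Pcal L N.+1 eps).
Local Notation t0 := (ord0 : 'I_N.+1).
Local Notation Q := (rho0 t0 rho).
Local Notation V := (Vop N.+1 eps H).
Local Notation S := (eSt eps H t0).
Local Notation S2 := (eSt2 N.+1 eps H).

Definition slice_evol (t : 'I_N.+1) (x : R) : 'M[C]_D := expm (Complex 0 x *: Hs H t).

Lemma Hs_adj (t : 'I_N.+1) : adj (Hs H t) = Hs H t.
Proof. by rewrite /Hs slice_adj Hadj. Qed.

Lemma expm_iZ_intertwine D' (X A B : 'M[C]_D') (x : R) :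
  X * A = B * X -> X * expm (Complex 0 x *: A) = expm (Complex 0 x *: B) * X.
Proof.
move=> h; apply: expm_intertwine; rewrite -scalemxAr -scalemxAl; congr (_ *: _).
exact: h.
Qed.

Lemma slice_evol_comm t u x y :
  slice_evol t x * slice_evol u y = slice_evol u y * slice_evol t x.
Proof.
have [->|tu] := eqVneq t u.
  by apply: expm_iC; apply: Hs_adj.
(* Exponentiating one factor at a time leaves the commutation of the two placed Hamiltonians, which
   are even and on distinct slices. *)
by do 2 (apply: expm_iZ_intertwine; symmetry); apply: slice_comm; rewrite 1?eq_sym.
Qed.

Lemma slice_evol_unitary t x : adj (slice_evol t x) * slice_evol t x = 1.
Proof. by rewrite /slice_evol adj_expm_i ?Hs_adj//; apply: expm_iVl; rewrite Hs_adj. Qed.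

Lemma Vop_unitary : adj V * V = 1.
Proof. by apply: prod_unitary => t; apply: slice_evol_unitary. Qed.

Lemma eSt_conj : S = adj V * Ut L N eps * V.
Proof.
rewrite /eSt /eS /Tt; symmetry.
apply: (@translation_conjugation R D N eps (Ut L N eps) slice_evol).
- by move=> t x y; apply: expm_iD; apply: Hs_adj.
- by move=> t; apply: expm_i0.
- exact: slice_evol_unitary.
- exact: slice_evol_comm.
- by move=> t x; apply: expm_iZ_intertwine; apply: Ut_slice_succ.
- by move=> x; apply: expm_iZ_intertwine; apply: Ut_slice_last.
Qed.

Lemma eSt2_sqr : S2 * S2 = S.
Proof.
rewrite eSt_conj; apply: conjugated_half_square; first exact: Vop_unitary.
exact/expm_i_halfsqr/Pcal_adj.
Qed.

Lemma PH_Vop : P * V = V * P.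
Proof.
by apply: prod_intertwine => t _; apply: expm_iZ_intertwine; apply: PH_slice.
Qed.

Lemma PH_eSt2 : P * S2 = S2 * P.
Proof.
apply: conjugated_comm; [exact: parity_adj | exact: PH_Vop |].
exact/expm_iZ_intertwine/PH_Pcal.
Qed.

Lemma PH_rho0 : P * Q = Q * P.
Proof. exact: PH_slice. Qed.

Lemma rho0_Vop : Q * V = V * Q.
Proof.
apply: prod_intertwine => t _.
(* [rho] and [H] may fail to commute on a common slice, but on slice 0 the evolution time in [Vop]
   is 0 and the factor is the identity. *)
have [->|t1] := eqVneq t t0; first by rewrite mulr0 scale0r expm0 mulr1 mul1r.
by apply: expm_iZ_intertwine; apply: slice_comm.
Qed.

Lemma trace_PH_rho0_eSt : \tr (P * Q * S) = \tr rho.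
Proof.
rewrite eSt_conj trace_conjugated.
- exact: trace_Ut_slice0.
- exact: Vop_unitary.
- exact: PH_Vop.
- exact: rho0_Vop.
- exact: PH_Ut.
Qed.

Lemma liftHK_mul (X Y : 'M[C]_D) : liftHK (X *m Y) = liftHK X *m liftHK Y.
Proof. exact/embed_mul/sys_car. Qed.

Lemma PsiBar_expectation (Y : 'M[C]_D) :
  (adj (PsiBar N.+1 eps H) *m liftHK Y *m Psi eps H t0 rho) 0 0 = \tr (P * Q * S * Y).
Proof.
rewrite /PsiBar /Psi bracket -!liftHK_mul PhiPlus_liftHK.
exact: (trace_half_square Y eSt2_sqr PH_eSt2 PH_rho0).
Qed.

Lemma overlapE : overlap eps H t0 rho = \tr (P * Q * S).
Proof.
rewrite /overlap /PsiBar /Psi bracket1 -!liftHK_mul PhiPlus_liftHK.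
exact: (trace_half_square1 eSt2_sqr PH_eSt2 PH_rho0).
Qed.

End DensityMatrix.

Unset Implicit Arguments.

Theorem theorem8 (R : realType) (L N : nat) (hL : (0 < L)%N) (hN : (0 < N)%N)
  (eps : R) (heps : 0 < eps)
  (H : 'M[R[i]]_(2 ^ L)) (hHherm : adj H = H)
  (hHeven : H *m parity R L = parity R L *m H)
  (rho : 'M[R[i]]_(2 ^ L)) (hrho : density rho) (htr : 0 < \tr rho)
  (hrhoeven : rho *m parity R L = parity R L *m rho) :
  let t0 := Ordinal hN in
  let Rk := Rop (L:=L) (N:=N) eps H t0 rho in
  overlap (L:=L) (N:=N) eps H t0 rho != 0
  /\ Rk *m Rk = Rk
  /\ \tr Rk = 1
  /\ forall O : 'I_N -> 'M[R[i]]_(2 ^ L),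
       \tr (PH R L N *m rho0 (L:=L) (N:=N) t0 rho *m eSt (L:=L) (N:=N) eps H t0
              *m \prod_(t < N) slice (L:=L) (N:=N) t (O t))
         / \tr (PH R L N *m rho0 (L:=L) (N:=N) t0 rho *m eSt (L:=L) (N:=N) eps H t0)
       = \tr (Rk *m liftHK (L:=L) (N:=N) (\prod_(t < N) slice (L:=L) (N:=N) t (O t))).
Proof.
(* A successor number of slices makes [ord0] and [ord_max] available; the given slice 0 is then
   identified with [ord0]. *)
case: N hN => // N' hN' t0 Rk.
have t0E : t0 = ord0 by apply: val_inj.
have Heven := even_op_parity hHeven; have rhoeven := even_op_parity hrhoeven.
have trPQS := trace_PH_rho0_eSt N' heps hHherm Heven rhoeven.
have ovE := overlapE N' heps hHherm Heven rhoeven.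
have bra (Y : 'M[R[i]]_(2 ^ (N'.+1 * L))) :=
  PsiBar_expectation heps hHherm Heven rhoeven Y.
have ov0 : overlap eps H (ord0 : 'I_N'.+1) rho != 0.
  by rewrite ovE trPQS; apply: lt0r_neq0.
move: @Rk; rewrite t0E => Rk.
have [RR tR RY] := rank1_projector ov0.
split=> //; split=> //; split=> // O.
rewrite [RHS]RY bra mulrC; congr (_^-1 * _).
exact/esym/ovE.
Qed.
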